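(* Let $I\subset\mathbb{R}$ be an open interval, let $\beta\colon I\to\mathbb{S}^2$ be a smooth curve with $|\beta'(s)|=1$ for all $s\in I$, let $a,b\colon I\to\mathbb{R}$ be smooth functions, and let $\Sigma$ be the non-cylindrical ruled surface in $\mathbb{R}^3$ parametrized by $$X\colon I\times\mathbb{R}\to\mathbb{R}^3,\qquad X(s,t)=\alpha(s)+t\,\beta(s),\qquad \alpha(s)=a(s)\,\beta'(s)+b(s)\,\beta(s)\times\beta'(s).$$ If the anisotropic mean curvature of $\Sigma$ for the Dirichlet energy is a constant $\Lambda\in\mathbb{R}$, then $\beta$ is (contained in) a great circle of $\mathbb{S}^2$. Moreover, up to a rotation about the $z$-axis and translations of $\mathbb{R}^3$, the surface $\Sigma$ is one of the following surfaces. (1) Case $\Lambda=0$: (a) a plane; (b) a helicoid: $\beta$ is the horizontal equator $\beta(s)=(\cos s,\sin s,0)$ and $$a(s)=c_1\cos s,\qquad b(s)=b_1 s,\qquad c_1\neq 0,\ b_1\neq 0;$$ (c) $\beta$ is the vertical equator $\beta(s)=(\cos s,0,\sin s)$ and $$a(s)=c_1\cos(s+c_2),\qquad b(s)=b_1\tan s,\qquad c_1,c_2\in\mathbb{R},\ c_1\neq 0,\ b_1\neq 0;$$ (d) $\beta$ is a non-horizontal, non-vertical great circle, $\beta(s)=(\cos s,\sqrt{1-m^2}\,\sin s,m\sin s)$ with $m\in(0,1)$, and $$a(s)=c_1\cos s+c_2\sin s-\frac{b_1 m}{1-m^2}\cos s\,\cot^{-1}\!\big(\sqrt{1-m^2}\,\tan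 s\big)+\frac{b_1}{m\sqrt{1-m^2}}\sin s,$$ $$b(s)=\frac{b_1}{\sqrt{1-m^2}}\tan^{-1}\!\big(\sqrt{1-m^2}\,\tan s\big),$$ where $c_1,c_2,b_1\in\mathbb{R}$ and $b_1\neq 0$. (2) Case $\Lambda\neq 0$: $\beta$ is the vertical equator $\beta(s)=(\cos s,0,\sin s)$ and $$a(s)=c_1\cos s+c_2\sin s-\frac{\Lambda b_1^2\cos(2s)}{4\cos s},\qquad b(s)=b_1\tan s,\qquad c_1,c_2\in\mathbb{R},\ b_1\neq 0.$$
   Context: $\mathbb{S}^2\subset\mathbb{R}^3$ is the unit sphere, $(x,y,z)$ are the coordinates of $\mathbb{R}^3$, and $e_3=(0,0,1)$. The Dirichlet energy of a surface $\Sigma$ with unit normal $\nu=(\nu_1,\nu_2,\nu_3)$ is $\mathcal{F}(\Sigma)=\int_\Sigma\left(\frac{1}{\nu_3}-\nu_3\right)d\Sigma$; it equals $\int_\Omega|Du|^2$ when $\Sigma$ is the graph $z=u(x,y)$ over $\Omega$. It is only considered at regular points of the surface where $\nu_3\neq0$. Near such a point $\Sigma$ is a graph $z=u(x,y)$, and the anisotropic mean curvature $\Lambda$ of $\Sigma$ for the Dirichlet energy is $\Lambda=2(u_{xx}+u_{yy})$. Equivalently, when $\nu_3^2\ne 1$, with $h(v,w)=-\langle d\nu(v),w\rangle$, $E_1=e_3-\nu_3\nu$ and $E_2=\nu\times E_1$, it is determined by $\Lambda\nu_3^3(1-\nu_3^2)=2\left(h(E_1,E_1)+\nu_3^2\,h(E_2,E_2)\right)$;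 this does not depend on the choice of orientation $\nu$. Surfaces with constant $\Lambda$ are the stationary surfaces (critical points for compactly supported volume-preserving variations) of the energy. For the ruled surface $X$, the unit normal is $\nu=\frac{X_s\times X_t}{|X_s\times X_t|}$ at the points where $X_s\times X_t\neq0$. The points $(s,t)$ where $X_s\times X_t\ne0$ and $\nu_3\neq0$ are assumed to be dense in $I\times\mathbb{R}$, and ''the anisotropic mean curvature is the constant $\Lambda$'' means that it equals $\Lambda$ at all these points. A ruled surface $X(s,t)=\alpha(s)+t\beta(s)$ is cylindrical if $\beta$ is constant. For a non-cylindrical one, $\beta$ is taken to be parametrized by arc-length and the directrix $\alpha$ is chosen with $\langle\alpha(s),\beta(s)\rangle=0$; then $\{\beta,\beta',\beta\times\beta'\}$ is an orthonormal frame and $\alpha=a\beta'+b\,\beta\times\beta'$. Surfaces are identified when they differ by reparametrization of the rulings' parameter $s\mapsto\pm s+\text{const}$. In each item, the functions $a,b$ determine the surface through $X(s,t)=a(s)\beta'(s)+b(s)\,\beta(s)\times\beta'(s)+t\beta(s)$. The results are local: $I$ may be replaced by a smaller open interval, in particular one on which the displayed functions are defined and smooth. The convention is $\cot^{-1}(x)=\frac{\pi}{2}-\tan^{-1}(x)$. *)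

(* Defs.v *)
From Stdlib Require Import Reals.
From Coquelicot Require Import Coquelicot.
Open Scope R_scope.

Definition vec3 : Type := (R * R * R)%type.

Definition vx (p : vec3) : R := fst (fst p).
Definition vy (p : vec3) : R := snd (fst p).
Definition vz (p : vec3) : R := snd p.

Definition vadd (p q : vec3) : vec3 := (vx p + vx q, vy p + vy q, vz p + vz q).
Definition vscal (k : R) (p : vec3) : vec3 := (k * vx p, k * vy p, k * vz p).
Definition dot (p q : vec3) : R := vx p * vx q + vy p * vy q + vz p * vz q.
Definition vnorm (p : vec3) : R := sqrt (dot p p).
Definition cross (p q : vec3) : vec3 :=
  (vy p * vz q - vz p * vy q, vz p * vx q - vx p * vz q, vx p * vy q - vy p * vx q).

Definition vderive (f : R -> vec3) (s : R) : vec3 :=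
  (Derive (fun r => vx (f r)) s, Derive (fun r => vy (f r)) s,
   Derive (fun r => vz (f r)) s).

Definition rotz (theta : R) (p : vec3) : vec3 :=
  (cos theta * vx p - sin theta * vy p, sin theta * vx p + cos theta * vy p, vz p).

(* A nonempty open interval is given by its endpoints [lo < hi] in [Rbar]. *)
Definition in_itv (lo hi : Rbar) (s : R) : Prop := Rbar_lt lo s /\ Rbar_lt s hi.

Definition smooth_on (lo hi : Rbar) (f : R -> R) : Prop :=
  forall (n : nat) (s : R), in_itv lo hi s -> ex_derive_n f n s.

Definition vsmooth_on (lo hi : Rbar) (f : R -> vec3) : Prop :=
  smooth_on lo hi (fun s => vx (f s)) /\
  smooth_on lo hi (fun s => vy (f s)) /\
  smooth_on lo hi (fun s => vz (f s)).

Definition cross_partials (X : R -> R -> vec3) (s t : R) : vec3 :=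
  cross (vderive (fun r => X r t) s) (vderive (fun r => X s r) t).

Definition unit_normal (X : R -> R -> vec3) (s t : R) : vec3 :=
  vscal (/ vnorm (cross_partials X s t)) (cross_partials X s t).

Definition admissible (X : R -> R -> vec3) (s t : R) : Prop :=
  cross_partials X s t <> (0, 0, 0) /\ vz (unit_normal X s t) <> 0.

Definition densely_admissible (lo hi : Rbar) (X : R -> R -> vec3) : Prop :=
  forall s t eps : R, in_itv lo hi s -> 0 < eps ->
  exists s' t' : R, in_itv lo hi s' /\ Rabs (s' - s) < eps /\ Rabs (t' - t) < eps /\
    admissible X s' t'.

(* At an admissible point [(s, t)] the projection of [X] to the (x,y)-plane is a
   local diffeomorphism, so a function [u] whose graph is the surface near
   [X s t] exists, and its germ at that point is unique.  [u] is required to be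
   of class C^2 near the point. *)
Definition is_aniso_mean_curvature (X : R -> R -> vec3) (s t Lam : R) : Prop :=
  exists u : R -> R -> R,
    locally_2d (fun x y => ex_diff_n u 2 x y) (vx (X s t)) (vy (X s t)) /\
    locally_2d (fun s' t' => vz (X s' t') = u (vx (X s' t')) (vy (X s' t'))) s t /\
    Lam = 2 * (partial_derive 2 0 u (vx (X s t)) (vy (X s t)) +
               partial_derive 0 2 u (vx (X s t)) (vy (X s t))).

Definition directrix (beta : R -> vec3) (a b : R -> R) (s : R) : vec3 :=
  vadd (vscal (a s) (vderive beta s)) (vscal (b s) (cross (beta s) (vderive beta s))).

Definition ruled (beta : R -> vec3) (a b : R -> R) (s t : R) : vec3 :=
  vadd (directrix beta a b s) (vscal t (beta s)).

Definition in_great_circle (lo hi : Rbar) (beta : R -> vec3) : Prop :=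
  exists n : vec3, vnorm n = 1 /\
    forall s, in_itv lo hi s -> vnorm (beta s) = 1 /\ dot n (beta s) = 0.

Definition in_plane (lo hi : Rbar) (X : R -> R -> vec3) : Prop :=
  exists (n : vec3) (d : R), vnorm n = 1 /\
    forall s t, in_itv lo hi s -> dot n (X s t) = d.

(* Over the interval, the rotation by [theta] about the z-axis followed by the
   translation by [v] carries the ruling of parameter [s] of the first surface
   onto the ruling of parameter [eps * s + c] of the second one.  The shift [tau]
   along the ruling is needed because a translation does not preserve the
   normalization of the directrix (orthogonality to [beta]). *)
Definition congruent_on (lo hi : Rbar) (theta : R) (v : vec3) (eps c : R)
    (beta : R -> vec3) (a b : R -> R) (beta0 : R -> vec3) (a0 b0 : R -> R) : Prop :=
  forall s, in_itv lo hi s -> exists tau : R, forall t,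
    vadd (rotz theta (ruled beta a b s t)) v = ruled beta0 a0 b0 (eps * s + c) (t + tau).

(* Up to a rotation about the z-axis, a translation and a reparametrization
   [s |-> eps * s + c] with [eps = 1] or [eps = -1], the curve [beta] is [beta0]
   and the surface is given by a pair [(a0, b0)] in [family].  The set [dom] is
   the set where the functions of the family are defined and smooth; the
   description of the surface holds over every open subinterval which the
   reparametrization maps into [dom].  The translation and the constants of the
   family may depend on that subinterval: integration constants jump at the
   points outside [dom]. *)
Definition is_model (lo hi : Rbar) (beta : R -> vec3) (a b : R -> R)
    (beta0 : R -> vec3) (dom : R -> Prop)
    (family : (R -> R) -> (R -> R) -> Prop) : Prop :=
  exists theta eps c : R, (eps = 1 \/ eps = -1) /\
    (forall s, in_itv lo hi s -> rotz theta (beta s) = beta0 (eps * s + c)) /\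
    forall lo' hi' : Rbar, Rbar_le lo lo' -> Rbar_lt lo' hi' -> Rbar_le hi' hi ->
      (forall s, in_itv lo' hi' s -> dom (eps * s + c)) ->
      exists (a0 b0 : R -> R) (v : vec3), family a0 b0 /\
        congruent_on lo' hi' theta v eps c beta a b beta0 a0 b0.

(* [tan] is only meaningful where [cos] does not vanish. *)
Definition tan_dom (s : R) : Prop := cos s <> 0.

Definition acot (x : R) : R := PI / 2 - atan x.

Definition horizontal_equator (s : R) : vec3 := (cos s, sin s, 0).
Definition vertical_equator (s : R) : vec3 := (cos s, 0, sin s).
Definition tilted_circle (m : R) (s : R) : vec3 :=
  (cos s, sqrt (1 - m ^ 2) * sin s, m * sin s).

Definition helicoid_family (a b : R -> R) : Prop :=
  exists c1 b1 : R, c1 <> 0 /\ b1 <> 0 /\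
    forall s, a s = c1 * cos s /\ b s = b1 * s.

Definition vertical_family (a b : R -> R) : Prop :=
  exists c1 c2 b1 : R, c1 <> 0 /\ b1 <> 0 /\
    forall s, tan_dom s -> a s = c1 * cos (s + c2) /\ b s = b1 * tan s.

Definition tilted_family (m : R) (a b : R -> R) : Prop :=
  exists c1 c2 b1 : R, b1 <> 0 /\
    forall s, tan_dom s ->
      a s = c1 * cos s + c2 * sin s
            - b1 * m / (1 - m ^ 2) * cos s * acot (sqrt (1 - m ^ 2) * tan s)
            + b1 / (m * sqrt (1 - m ^ 2)) * sin s /\
      b s = b1 / sqrt (1 - m ^ 2) * atan (sqrt (1 - m ^ 2) * tan s).

Definition vertical_cmc_family (Lam : R) (a b : R -> R) : Prop :=
  exists c1 c2 b1 : R, b1 <> 0 /\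
    forall s, tan_dom s ->
      a s = c1 * cos s + c2 * sin s - Lam * b1 ^ 2 * cos (2 * s) / (4 * cos s) /\
      b s = b1 * tan s.

(* Main.v *)
(* Write [beta'' = - beta + k E] with [E = beta x beta'], and let [f], [g], [n] be the heights of
   [beta], [beta'], [E].  With [p = b' + k a] and [w = t + a' - k b] one has
   [X_s x X_t = p beta' - w E], and [Delta u = Lam / 2] becomes, at each [s], an identity between
   cubic polynomials in [w]:
     [Lam / 2 (p g - w n)^3 = (1 - f^2) (- k w^2 - p' w + p (w_s - a - k p))
                              + 2 p (a (1 - f^2) + f g w + f n p)].
   The coefficient of [w^3] gives [Lam n = 0], then that of [w^2] gives [k (1 - f^2) = 0].  As
   [f^2 = 1] only at isolated points, [k = 0]: [E] is constant and [beta] runs along a great circle.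
   The other two coefficients are then
     [((1 - f^2) b')' = 0],
     [Lam / 2 b'^3 g^3 = b' ((1 - f^2) (a'' + a) + 2 f n b')],
   so that [(1 - f^2) b' = C].  If [C = 0] the surface is planar; otherwise [b'] and [a'' + a] are
   explicit functions of the arc length of the circle, and [a] is determined up to solutions of
   [h'' + h = 0], which a translation removes. *)
Require Import Defs.
From Stdlib Require Import Reals Lra Lia.
From Coquelicot Require Import Coquelicot.
Open Scope R_scope.

(** * Calculus of functions of two variables *)

Lemma is_derive_Rmult (f g : R -> R) (s f' g' : R) :
  is_derive f s f' -> is_derive g s g' ->
  is_derive (fun r => f r * g r) s (f' * g s + f s * g').
Proof. intros; apply (is_derive_mult f g); trivial; intros; apply Rmult_comm. Qed.

(** One partial derivative near the point, continuous at it, and the other one at the point alone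
    already give total differentiability. *)
Lemma ex_diff_1_differentiable (f : R -> R -> R) (x y : R) :
  locally_2d (ex_diff_n f 1) x y ->
  differentiable_pt_lim f x y (Derive (fun r => f r y) x) (Derive (fun r => f x r) y).
Proof.
intros hf.
apply filterdiff_differentiable_pt_lim.
apply (is_derive_filterdiff f x y (fun v w => Derive (fun r => f r w) v)).
- apply (proj1 (locally_2d_locally
    (fun v w => is_derive (fun r => f r w) v (Derive (fun r => f r w) v)) x y)).
  revert hf; apply locally_2d_impl, locally_2d_forall.
  now intros v w [_ [h _]]; apply Derive_correct.
- now destruct (locally_2d_singleton _ _ _ hf) as [_ [_ [h _]]]; apply Derive_correct.
- destruct (locally_2d_singleton _ _ _ hf) as [_ [_ [_ [h _]]]].
  destruct h as [h _].
  now apply continuity_2d_pt_filterlim in h.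
Qed.

Lemma ex_diff_2_schwarz (f : R -> R -> R) (x y : R) :
  locally_2d (ex_diff_n f 2) x y ->
  Derive (fun r => Derive (fun q => f r q) y) x = Derive (fun r => Derive (fun q => f q r) x) y.
Proof.
intros hf; apply Schwarz.
- revert hf; apply locally_2d_impl, locally_2d_forall.
  intros v w (_ & h1 & h2 & h3 & h4); repeat split; trivial.
  + now destruct h4 as (_ & h & _).
  + now destruct h3 as (_ & _ & h & _).
- destruct (locally_2d_singleton _ _ _ hf) as (_ & _ & _ & _ & h).
  now destruct h as (_ & _ & _ & h & _); destruct h.
- destruct (locally_2d_singleton _ _ _ hf) as (_ & _ & _ & h & _).
  now destruct h as (_ & _ & _ & _ & h); destruct h.
Qed.

(** Lets an identity valid near a point be differentiated at every nearby point, hence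
    differentiated twice at the point itself. *)
Lemma locally_2d_self (P : R -> R -> Prop) (x y : R) :
  locally_2d P x y -> locally_2d (locally_2d P) x y.
Proof. now apply locally_2d_impl_strong, locally_2d_forall; intros. Qed.

Lemma locally_2d_comp (P : R -> R -> Prop) (x y : R -> R -> R) (s t : R) :
  locally_2d P (x s t) (y s t) -> continuity_2d_pt x s t -> continuity_2d_pt y s t ->
  locally_2d (fun v w => P (x v w) (y v w)) s t.
Proof.
intros [d hd] hx hy.
generalize (locally_2d_and _ _ _ _ (hx d) (hy d)).
now apply locally_2d_impl, locally_2d_forall; intros v w [h1 h2]; apply hd.
Qed.

Lemma is_derive_comp_2d (f : R -> R -> R) (x y : R -> R) (r x' y' : R) :
  locally_2d (ex_diff_n f 1) (x r) (y r) -> is_derive x r x' -> is_derive y r y' ->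
  is_derive (fun q => f (x q) (y q)) r
    (Derive (fun q => f q (y r)) (x r) * x' + Derive (fun q => f (x r) q) (y r) * y').
Proof.
intros hf hx hy; apply is_derive_Reals, derivable_pt_lim_comp_2d.
- now apply ex_diff_1_differentiable.
- now apply is_derive_Reals.
- now apply is_derive_Reals.
Qed.

(** * The curvature equation in an arbitrary parametrization *)

Definition is_vderive (F : R -> vec3) (s : R) (v : vec3) : Prop :=
  is_derive (fun r => vx (F r)) s (vx v) /\
  is_derive (fun r => vy (F r)) s (vy v) /\
  is_derive (fun r => vz (F r)) s (vz v).

Definition hdot (p q : vec3) : R := vx p * vx q + vy p * vy q.

(* With [N = X_s x X_t], the functions [X_.. . N / N_z] are the coefficients of the pull-back of
   the Hessian of [u], whose trace is taken with respect to the horizontal metric [hdot]; the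
   determinant of the latter is [N_z ^ 2]. *)
Lemma aniso_mean_curvature_eq (X Xs Xt : R -> R -> vec3) (Xss Xst Xtt : vec3) (s t Lam : R) :
  locally_2d (fun v w => is_vderive (fun r => X r w) v (Xs v w)) s t ->
  locally_2d (fun v w => is_vderive (fun r => X v r) w (Xt v w)) s t ->
  continuity_2d_pt (fun v w => vx (X v w)) s t ->
  continuity_2d_pt (fun v w => vy (X v w)) s t ->
  is_vderive (fun r => Xs r t) s Xss ->
  is_vderive (fun r => Xt r t) s Xst ->
  is_vderive (fun r => Xt s r) t Xtt ->
  is_aniso_mean_curvature X s t Lam ->
  let N := cross (Xs s t) (Xt s t) in
  Lam / 2 * vz N ^ 3 =
    dot Xss N * hdot (Xt s t) (Xt s t) - 2 * dot Xst N * hdot (Xs s t) (Xt s t)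
    + dot Xtt N * hdot (Xs s t) (Xs s t).
Proof.
intros hs ht cx cy hss hst htt (u & hu & hz & ->) N.
set (x0 := vx (X s t)) in *; set (y0 := vy (X s t)) in *.
pose (ux := fun v w => Derive (fun r => u r w) v).
pose (uy := fun v w => Derive (fun r => u v r) w).
assert (hux : locally_2d (ex_diff_n ux 1) x0 y0).
{ revert hu; apply locally_2d_impl, locally_2d_forall; intros v w h.
  now destruct h as (_ & _ & _ & h & _). }
assert (huy : locally_2d (ex_diff_n uy 1) x0 y0).
{ revert hu; apply locally_2d_impl, locally_2d_forall; intros v w h.
  now destruct h as (_ & _ & _ & _ & h). }
assert (hu1 : locally_2d (locally_2d (ex_diff_n u 1)) x0 y0).
{ apply locally_2d_self; revert hu; apply locally_2d_impl, locally_2d_forall.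
  now intros v w; apply ex_diff_n_m; auto. }
pose proof (locally_2d_comp _ (fun v w => vx (X v w)) (fun v w => vy (X v w)) s t hu1 cx cy) as hu2.
assert (hz' : locally_2d (fun v w => locally_2d (fun s' t' =>
  vz (X s' t') = u (vx (X s' t')) (vy (X s' t'))) v w) s t).
{ now apply locally_2d_self. }
(* The chain rule on [z = u (x, y)] is recorded on a whole neighbourhood and not only at [(s, t)],
   since it is differentiated once more below. *)
assert (es : locally_2d (fun v w => vz (Xs v w) =
   ux (vx (X v w)) (vy (X v w)) * vx (Xs v w) + uy (vx (X v w)) (vy (X v w)) * vy (Xs v w)) s t).
{ generalize (locally_2d_and _ _ _ _ (locally_2d_and _ _ _ _ hs hz') hu2).
  apply locally_2d_impl, locally_2d_forall.
  intros v w [[(h1 & h2 & h3) h4] h5].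
  transitivity (Derive (fun r => vz (X r w)) v); [now symmetry; apply is_derive_unique|].
  rewrite (Derive_ext_loc _ (fun r => u (vx (X r w)) (vy (X r w)))).
  - apply is_derive_unique.
    now apply (is_derive_comp_2d u (fun r => vx (X r w)) (fun r => vy (X r w))).
  - exact (locally_2d_1d_const_y _ _ _ h4). }
assert (et : locally_2d (fun v w => vz (Xt v w) =
   ux (vx (X v w)) (vy (X v w)) * vx (Xt v w) + uy (vx (X v w)) (vy (X v w)) * vy (Xt v w)) s t).
{ generalize (locally_2d_and _ _ _ _ (locally_2d_and _ _ _ _ ht hz') hu2).
  apply locally_2d_impl, locally_2d_forall.
  intros v w [[(h1 & h2 & h3) h4] h5].
  transitivity (Derive (fun r => vz (X v r)) w); [now symmetry; apply is_derive_unique|].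
  rewrite (Derive_ext_loc _ (fun r => u (vx (X v r)) (vy (X v r)))).
  - apply is_derive_unique.
    now apply (is_derive_comp_2d u (fun r => vx (X v r)) (fun r => vy (X v r))).
  - exact (locally_2d_1d_const_x _ _ _ h4). }
destruct (locally_2d_singleton _ _ _ hs) as (xs & ys & _).
destruct (locally_2d_singleton _ _ _ ht) as (xt & yt & _).
(* One statement covers the derivatives [ss], [st] and [tt]: [F] is a coordinate curve of [X] with
   velocity [F'], and [G] is [Xs] or [Xt] along that curve. *)
assert (second : forall (F : R -> vec3) (G : R -> vec3) (r : R) (F' G' : vec3),
  F r = X s t -> is_derive (fun q => vx (F q)) r (vx F') -> is_derive (fun q => vy (F q)) r (vy F') ->
  is_vderive G r G' ->
  locally r (fun q => vz (G q) =
    ux (vx (F q)) (vy (F q)) * vx (G q) + uy (vx (F q)) (vy (F q)) * vy (G q)) ->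
  vz G' = (Derive (fun q => ux q y0) x0 * vx F' + Derive (fun q => ux x0 q) y0 * vy F') * vx (G r)
    + ux x0 y0 * vx G' +
    ((Derive (fun q => uy q y0) x0 * vx F' + Derive (fun q => uy x0 q) y0 * vy F') * vy (G r)
    + uy x0 y0 * vy G')).
{ intros F G r F' G' e hx hy (g1 & g2 & g3) h.
  transitivity (Derive (fun q => vz (G q)) r); [now symmetry; apply is_derive_unique|].
  etransitivity; [apply Derive_ext_loc, h|].
  apply is_derive_unique.
  assert (ex : x0 = vx (F r)) by now rewrite e.
  assert (ey : y0 = vy (F r)) by now rewrite e.
  rewrite ex, ey in hux, huy |- *.
  apply (is_derive_plus (V := R_NormedModule)
    (fun q => ux (vx (F q)) (vy (F q)) * vx (G q)) (fun q => uy (vx (F q)) (vy (F q)) * vy (G q))).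
  - apply (is_derive_Rmult (fun q => ux (vx (F q)) (vy (F q))) (fun q => vx (G q))); trivial.
    now apply is_derive_comp_2d.
  - apply (is_derive_Rmult (fun q => uy (vx (F q)) (vy (F q))) (fun q => vy (G q))); trivial.
    now apply is_derive_comp_2d. }
pose proof (second (fun r => X r t) (fun r => Xs r t) s (Xs s t) Xss eq_refl xs ys hss
  (locally_2d_1d_const_y _ _ _ es)) as Ess.
pose proof (second (fun r => X r t) (fun r => Xt r t) s (Xs s t) Xst eq_refl xs ys hst
  (locally_2d_1d_const_y _ _ _ et)) as Est.
pose proof (second (fun r => X s r) (fun r => Xt s r) t (Xt s t) Xtt eq_refl xt yt htt
  (locally_2d_1d_const_x _ _ _ et)) as Ett.
pose proof (locally_2d_singleton _ _ _ es) as Es.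
pose proof (locally_2d_singleton _ _ _ et) as Et.
assert (hsym : Derive (fun q => uy q y0) x0 = Derive (fun q => ux x0 q) y0).
{ exact (ex_diff_2_schwarz u x0 y0 hu). }
simpl in Es, Et; fold x0 y0 in Es, Et.
assert (e20 : partial_derive 2 0 u x0 y0 = Derive (fun q => ux q y0) x0) by reflexivity.
assert (e02 : partial_derive 0 2 u x0 y0 = Derive (fun q => uy x0 q) y0) by reflexivity.
rewrite e20, e02; clear e20 e02.
rewrite hsym in *.
unfold N, dot, hdot, cross, vx, vy, vz in *; simpl in *.
(* Once all heights are eliminated, the gradient of [u] cancels and both sides are the same
   polynomial in the Hessian of [u] and the horizontal components of [Xs] and [Xt]. *)
rewrite Es, Et, Ess, Est, Ett.
field.
Qed.

(** * Functions on an open interval *)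

Lemma in_itv_locally (lo hi : Rbar) (s : R) :
  in_itv lo hi s -> locally s (in_itv lo hi).
Proof.
intros [h1 h2]; apply (filter_and (F := locally s)).
- now apply (open_Rbar_gt' s lo).
- now apply (open_Rbar_lt' s hi).
Qed.

Lemma in_itv_between (lo hi : Rbar) (r s q : R) :
  in_itv lo hi r -> in_itv lo hi s -> r <= q <= s -> in_itv lo hi q.
Proof.
intros [h1 _] [_ h2] [h3 h4]; split.
- now apply Rbar_lt_le_trans with r.
- now apply Rbar_le_lt_trans with s.
Qed.

Lemma derive_zero_const (lo hi : Rbar) (f : R -> R) :
  (forall s, in_itv lo hi s -> is_derive f s 0) ->
  forall r s, in_itv lo hi r -> in_itv lo hi s -> f r = f s.
Proof.
intros h.
assert (lt : forall r s, in_itv lo hi r -> in_itv lo hi s -> r < s -> f r = f s).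
{ intros r s hr hs hrs; apply eq_is_derive; trivial.
  intros q hq; apply h; now apply (in_itv_between lo hi r s). }
intros r s hr hs; destruct (Rtotal_order r s) as [c|[->|c]]; auto.
now symmetry; apply lt.
Qed.

Lemma smooth_on_derive (lo hi : Rbar) (f : R -> R) (s : R) :
  smooth_on lo hi f -> in_itv lo hi s -> is_derive f s (Derive f s).
Proof. intros h hs; apply Derive_correct, (h 1%nat s hs). Qed.

Lemma smooth_on_Derive (lo hi : Rbar) (f : R -> R) :
  smooth_on lo hi f -> smooth_on lo hi (Derive f).
Proof.
intros h [|n] s hs; [exact I|].
apply (ex_derive_ext (Derive_n f (S n))).
- intros r; rewrite <- Nat.add_1_r; symmetry; exact (Derive_n_comp f n 1 r).
- exact (h (S (S n)) s hs).
Qed.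

(** * The moving frame of a unit-speed curve on the sphere *)

Lemma vnorm_1 (p : vec3) : vnorm p = 1 -> dot p p = 1.
Proof. intros h; apply sqrt_lem_0 in h; try lra. unfold dot; nra. Qed.

Lemma is_vderive_dot (F G : R -> vec3) (s : R) (F' G' : vec3) :
  is_vderive F s F' -> is_vderive G s G' ->
  is_derive (fun r => dot (F r) (G r)) s (dot F' (G s) + dot (F s) G').
Proof.
intros (f1 & f2 & f3) (g1 & g2 & g3); unfold dot.
evar_last.
- apply (is_derive_plus (V := R_NormedModule)); [|apply is_derive_Rmult; eassumption].
  apply (is_derive_plus (V := R_NormedModule)); apply is_derive_Rmult; eassumption.
- unfold plus; simpl; ring.
Qed.

Lemma is_vderive_cross (F G : R -> vec3) (s : R) (F' G' : vec3) :
  is_vderive F s F' -> is_vderive G s G' ->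
  is_vderive (fun r => cross (F r) (G r)) s (vadd (cross F' (G s)) (cross (F s) G')).
Proof.
intros (f1 & f2 & f3) (g1 & g2 & g3).
split; [|split]; unfold cross, vadd; unfold vx, vy, vz in *; simpl in *.
all: evar_last;
  [apply (is_derive_minus (V := R_NormedModule)); apply is_derive_Rmult; eassumption
  |unfold minus, plus, opp; simpl; ring].
Qed.

Lemma vec3_ext (p q : vec3) : vx p = vx q -> vy p = vy q -> vz p = vz q -> p = q.
Proof. destruct p as [[? ?] ?], q as [[? ?] ?]; unfold vx, vy, vz; simpl; congruence. Qed.

(** The Darboux frame of a spherical curve, [k] being its geodesic curvature. It is stated at one
    point and with a number [k], so that [k] can later be replaced by [0]. *)
Record frame_at (s : R) (B D E : R -> vec3) (k : R) : Prop := {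
  frame_BB : dot (B s) (B s) = 1;
  frame_DD : dot (D s) (D s) = 1;
  frame_BD : dot (B s) (D s) = 0;
  frame_E : E s = cross (B s) (D s);
  frame_dB : is_vderive B s (D s);
  frame_dD : is_vderive D s (vadd (vscal (-1) (B s)) (vscal k (E s)));
  frame_dE : is_vderive E s (vscal (- k) (D s)) }.

(** The difference [r] of the two sides is orthogonal to [p], [q] and [cross p q]. Cramer's rule for
    these three vectors, whose determinant is the squared norm of [cross p q], that is 1, gives
    [r = 0]. *)
Lemma frame_decomposition (p q v : vec3) :
  dot p p = 1 -> dot q q = 1 -> dot p q = 0 ->
  v = vadd (vscal (dot v p) p)
        (vadd (vscal (dot v q) q) (vscal (dot v (cross p q)) (cross p q))).
Proof.
intros hp hq hpq.
pose (r := vadd v (vscal (-1) (vadd (vscal (dot v p) p)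
        (vadd (vscal (dot v q) q) (vscal (dot v (cross p q)) (cross p q)))))).
assert (hc : dot (cross p q) (cross p q) = 1).
{ replace (dot (cross p q) (cross p q)) with (dot p p * dot q q - dot p q ^ 2);
    [rewrite hp, hq, hpq; ring|unfold dot, cross, vx, vy, vz; simpl; ring]. }
assert (rp : dot r p = 0).
{ replace (dot r p) with (dot v p * (1 - dot p p) - dot v q * dot p q);
    [rewrite hp, hpq; ring|].
  unfold r, dot, cross, vadd, vscal, vx, vy, vz; simpl; ring. }
assert (rq : dot r q = 0).
{ replace (dot r q) with (dot v q * (1 - dot q q) - dot v p * dot p q);
    [rewrite hq, hpq; ring|].
  unfold r, dot, cross, vadd, vscal, vx, vy, vz; simpl; ring. }
assert (rc : dot r (cross p q) = 0).
{ replace (dot r (cross p q)) with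
    (dot v (cross p q) * (1 - dot (cross p q) (cross p q)));
    [rewrite hc; ring|].
  unfold r, dot, cross, vadd, vscal, vx, vy, vz; simpl; ring. }
assert (cramer : vscal (dot (cross p q) (cross p q)) r =
  vadd (vscal (dot r p) (cross q (cross p q)))
    (vadd (vscal (dot r q) (cross (cross p q) p)) (vscal (dot r (cross p q)) (cross p q)))).
{ clear; generalize r; clear; intros r.
  apply vec3_ext; unfold dot, cross, vadd, vscal, vx, vy, vz; simpl; ring. }
rewrite rp, rq, rc, hc in cramer.
pose proof (f_equal vx cramer) as ex; pose proof (f_equal vy cramer) as ey;
  pose proof (f_equal vz cramer) as ez.
clear cramer; unfold r in ex, ey, ez; apply vec3_ext;
  revert ex ey ez; unfold vadd, vscal, vx, vy, vz; simpl; lra.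
Qed.

(** Differentiating [|beta| = 1], [|beta'| = 1] and [beta . beta' = 0] fixes the components of
    [beta''] along [beta'] and [beta]; the remaining one is [k]. The third derivative of [beta]
    makes [k] differentiable. *)
Lemma frame_exists (lo hi : Rbar) (beta : R -> vec3) :
  vsmooth_on lo hi beta ->
  (forall s, in_itv lo hi s -> vnorm (beta s) = 1) ->
  (forall s, in_itv lo hi s -> vnorm (vderive beta s) = 1) ->
  exists k : R -> R, forall s, in_itv lo hi s ->
    ex_derive k s /\
    frame_at s beta (vderive beta) (fun r => cross (beta r) (vderive beta r)) (k s).
Proof.
intros (sx & sy & sz) hB hD.
set (D := vderive beta) in *.
pose (D' := fun s => vderive D s).
exists (fun s => dot (D' s) (cross (beta s) (D s))).
assert (dB : forall s, in_itv lo hi s -> is_vderive beta s (D s)).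
{ intros s hs; repeat split; now apply (smooth_on_derive lo hi). }
assert (dD : forall s, in_itv lo hi s -> is_vderive D s (D' s)).
{ intros s hs; repeat split; apply (smooth_on_derive lo hi); trivial;
    now apply smooth_on_Derive. }
assert (dD' : forall s, in_itv lo hi s -> is_vderive D' s (vderive D' s)).
{ intros s hs; repeat split; apply (smooth_on_derive lo hi); trivial;
    now apply smooth_on_Derive, smooth_on_Derive. }
assert (zero : forall F c s l, in_itv lo hi s -> (forall r, in_itv lo hi r -> F r = c) ->
  is_derive F s l -> l = 0).
{ intros F c s l hs hF hd.
  rewrite <- (is_derive_unique _ _ _ hd).
  rewrite (Derive_ext_loc F (fun _ => c)); [apply Derive_const|].
  now apply (filter_imp (in_itv lo hi)); [|apply in_itv_locally]. }
assert (BB : forall s, in_itv lo hi s -> dot (beta s) (beta s) = 1)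
  by now intros; apply vnorm_1, hB.
assert (DD : forall s, in_itv lo hi s -> dot (D s) (D s) = 1)
  by now intros; apply vnorm_1, hD.
assert (BD : forall s, in_itv lo hi s -> dot (beta s) (D s) = 0).
{ intros s hs.
  pose proof (zero _ _ s _ hs BB (is_vderive_dot _ _ _ _ _ (dB s hs) (dB s hs))) as h.
  revert h; unfold dot; lra. }
assert (DD' : forall s, in_itv lo hi s -> dot (D' s) (D s) = 0).
{ intros s hs.
  pose proof (zero _ _ s _ hs DD (is_vderive_dot _ _ _ _ _ (dD s hs) (dD s hs))) as h.
  revert h; unfold dot; lra. }
assert (BD' : forall s, in_itv lo hi s -> dot (D' s) (beta s) = -1).
{ intros s hs.
  pose proof (zero _ _ s _ hs BD (is_vderive_dot _ _ _ _ _ (dB s hs) (dD s hs))) as h.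
  revert h; rewrite (DD s hs); unfold dot; lra. }
intros s hs; split.
{ eexists; apply is_vderive_dot; [now apply dD'|].
  apply is_vderive_cross; [now apply dB|now apply dD]. }
assert (eD' : D' s = vadd (vscal (-1) (beta s))
   (vscal (dot (D' s) (cross (beta s) (D s))) (cross (beta s) (D s)))).
{ rewrite (frame_decomposition (beta s) (D s) (D' s)) at 1; auto.
  rewrite BD', DD' by trivial.
  apply vec3_ext; unfold vadd, vscal, vx, vy, vz; simpl; ring. }
constructor; auto.
- rewrite <- eD'; auto.
- pose proof (is_vderive_cross _ _ _ _ _ (dB s hs) (dD s hs)) as h.
  rewrite eD' in h.
  (* The double cross product: [beta x (beta x D) = (beta . D) beta - (beta . beta) D]. *)
  assert (e : forall k, vadd (cross (D s) (D s)) (cross (beta s)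
    (vadd (vscal (-1) (beta s)) (vscal k (cross (beta s) (D s)))))
    = vscal (- k) (vadd (vscal (dot (beta s) (beta s)) (D s))
         (vscal (- dot (beta s) (D s)) (beta s)))).
  { intros k; apply vec3_ext; unfold dot, vadd, vscal, cross, vx, vy, vz; simpl; ring. }
  rewrite e, BB, BD in h by trivial.
  match goal with |- is_vderive _ _ ?v => match type of h with is_vderive _ _ ?w =>
    replace v with w; trivial end end.
  apply vec3_ext; unfold vadd, vscal, vx, vy, vz; simpl; ring.
Qed.

Lemma is_vderive_unique (F : R -> vec3) (s : R) (v : vec3) :
  is_vderive F s v -> vderive F s = v.
Proof.
intros (h1 & h2 & h3).
now apply vec3_ext; unfold vderive, vx, vy, vz in *; simpl; apply is_derive_unique.
Qed.

Lemma is_vderive_ext (F G : R -> vec3) (s : R) (v : vec3) :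
  (forall r, F r = G r) -> is_vderive F s v -> is_vderive G s v.
Proof.
intros e (h1 & h2 & h3); split; [|split].
- now apply is_derive_ext with (2 := h1); intros r; rewrite e.
- now apply is_derive_ext with (2 := h2); intros r; rewrite e.
- now apply is_derive_ext with (2 := h3); intros r; rewrite e.
Qed.

Definition comb (p q r : vec3) (u v w : R) : vec3 :=
  vadd (vscal u p) (vadd (vscal v q) (vscal w r)).

(** Product rule in the moving frame: [- v], [u - k w] and [k v] are what the frame equations
    contribute to the three coordinates. *)
Lemma is_vderive_comb (B D E : R -> vec3) (k s : R) (u v w : R -> R) (u' v' w' : R) :
  frame_at s B D E k -> is_derive u s u' -> is_derive v s v' -> is_derive w s w' ->
  is_vderive (fun r => comb (B r) (D r) (E r) (u r) (v r) (w r)) s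
    (comb (B s) (D s) (E s) (u' - v s) (u s + v' - k * w s) (w' + k * v s)).
Proof.
intros [_ _ _ _ (b1 & b2 & b3) (d1 & d2 & d3) (e1 & e2 & e3)] hu hv hw.
split; [|split]; unfold comb, vadd, vscal; unfold vx, vy, vz in *; simpl in *.
all: evar_last;
  [apply (is_derive_plus (V := R_NormedModule)); [|apply (is_derive_plus (V := R_NormedModule))];
     apply is_derive_Rmult; eassumption
  |unfold plus, vscal, vx, vy, vz; simpl; ring].
Qed.

Lemma cross_comb (p q : vec3) (u v w : R) :
  dot p p = 1 -> dot p q = 0 ->
  cross (comb p q (cross p q) u v w) p = comb p q (cross p q) 0 w (- v).
Proof.
intros hp hq.
transitivity (vadd (vscal (w * dot p p) q)
  (vadd (vscal (- w * dot p q) p) (vscal (- v) (cross p q)))).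
- apply vec3_ext; unfold comb, dot, vadd, vscal, cross, vx, vy, vz; simpl; ring.
- rewrite hp, hq; apply vec3_ext; unfold comb, dot, vadd, vscal, vx, vy, vz; simpl; ring.
Qed.

Lemma dot_comb (p q : vec3) (u v w u' v' w' : R) :
  dot p p = 1 -> dot q q = 1 -> dot p q = 0 ->
  dot (comb p q (cross p q) u v w) (comb p q (cross p q) u' v' w') = u * u' + v * v' + w * w'.
Proof.
intros hp hq hpq.
transitivity (u * u' * dot p p + v * v' * dot q q + (u * v' + v * u') * dot p q
  + w * w' * (dot p p * dot q q - dot p q ^ 2)).
- unfold comb, dot, vadd, vscal, cross, vx, vy, vz; simpl; ring.
- rewrite hp, hq, hpq; ring.
Qed.

Lemma vz_comb (p q r : vec3) (u v w : R) :
  vz (comb p q r u v w) = u * vz p + v * vz q + w * vz r.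
Proof. unfold comb, vadd, vscal, vz; simpl; ring. Qed.

Lemma hdot_dot (p q : vec3) : hdot p q = dot p q - vz p * vz q.
Proof. unfold hdot, dot; ring. Qed.

(** * Vanishing criteria *)

(** A cubic with four distinct roots is zero. The excluded [w0] stands for the one place of a ruling
    where the surface may fail to be a graph. *)
Lemma cubic_vanish (c3 c2 c1 c0 w0 : R) :
  (forall w, w <> w0 -> c3 * w ^ 3 + c2 * w ^ 2 + c1 * w + c0 = 0) ->
  c3 = 0 /\ c2 = 0 /\ c1 = 0 /\ c0 = 0.
Proof.
intros h.
assert (h1 := h (w0 + 1)); assert (h2 := h (w0 + 2));
  assert (h3 := h (w0 + 3)); assert (h4 := h (w0 + 4)); clear h.
specialize (h1 ltac:(lra)); specialize (h2 ltac:(lra));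
  specialize (h3 ltac:(lra)); specialize (h4 ltac:(lra)).
assert (e3 : c3 = 0) by nra.
subst c3; assert (e2 : c2 = 0) by nra.
subst c2; assert (e1 : c1 = 0) by lra.
subst c1; repeat split; lra.
Qed.

Lemma locally_neq_0 (F : R -> R) (s : R) :
  ex_derive F s -> F s <> 0 -> locally s (fun r => F r <> 0).
Proof. intros dF h; exact (ex_derive_continuous F s dF _ (open_neq 0 (F s) h)). Qed.

(** By continuity a nonzero value would persist nearby. This carries identities from the rulings
    with an admissible point to all rulings. *)
Lemma zero_of_dense_zeros (F : R -> R) (s : R) :
  ex_derive F s ->
  (forall eps, 0 < eps -> exists r, Rabs (r - s) < eps /\ F r = 0) -> F s = 0.
Proof.
intros dF h; destruct (Req_dec (F s) 0) as [e|e]; trivial; exfalso.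
destruct (locally_neq_0 F s dF e) as [d hd].
destruct (h d (cond_pos d)) as (r & hr & er).
now apply (hd r).
Qed.

(** * Ruled surfaces in the moving frame, and their differential equations *)

Section RuledSurface.

Context (lo hi : Rbar) (B : R -> vec3) (k a b : R -> R).
Let D := vderive B.
Let E s := cross (B s) (D s).
Let X := ruled B a b.
(* The normal [X_s x X_t] is [N_D * beta' - N_E * (beta x beta')]. *)
Let N_D s := Derive b s + k s * a s.
Let N_E s t := t + Derive a s - k s * b s.

Context (frame : forall s, in_itv lo hi s -> frame_at s B D E (k s))
  (dk : forall s, in_itv lo hi s -> ex_derive k s)
  (ha : smooth_on lo hi a) (hb : smooth_on lo hi b).

Lemma ruled_comb (s t : R) : X s t = comb (B s) (D s) (E s) t (a s) (b s).
Proof.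
apply vec3_ext; unfold X, ruled, directrix, comb, vadd, vscal, E, D, vx, vy, vz; simpl; ring.
Qed.

Definition ruled_ds (s t : R) : vec3 :=
  comb (B s) (D s) (E s) (- a s) (N_E s t) (N_D s).

Lemma is_vderive_ruled_s (s t : R) :
  in_itv lo hi s -> is_vderive (fun r => X r t) s (ruled_ds s t).
Proof.
intros hs.
assert (h : is_vderive (fun r => comb (B r) (D r) (E r) t (a r) (b r)) s (ruled_ds s t)).
{ replace (ruled_ds s t) with (comb (B s) (D s) (E s)
    (0 - a s) (t + Derive a s - k s * b s) (Derive b s + k s * a s)).
  - apply is_vderive_comb; auto; [apply (is_derive_const (V := R_NormedModule))| |];
      now apply (smooth_on_derive lo hi).
  - unfold ruled_ds, N_D, N_E; f_equal; ring. }
revert h; apply is_vderive_ext; intros r; now rewrite ruled_comb.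
Qed.

Lemma is_vderive_ruled_t (s t : R) : is_vderive (fun r => X s r) t (B s).
Proof.
assert (lin : forall c d, is_derive (fun r => c + r * d) t d)
  by (intros; auto_derive; trivial; ring).
split; [|split]; apply lin.
Qed.

Lemma ruled_cross_partials (s t : R) :
  in_itv lo hi s ->
  cross_partials X s t = comb (B s) (D s) (E s) 0 (N_D s) (- N_E s t).
Proof.
intros hs; unfold cross_partials.
rewrite (is_vderive_unique _ _ _ (is_vderive_ruled_s s t hs)).
rewrite (is_vderive_unique _ _ _ (is_vderive_ruled_t s t)).
destruct (frame s hs); now apply cross_comb.
Qed.

(** A vector of nonzero height is nonzero, and normalizing only rescales its height. Admissibility
    is thus one inequation, affine in [t]. *)
Lemma ruled_admissible (s t : R) :
  in_itv lo hi s ->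
  admissible X s t <-> N_D s * vz (D s) - N_E s t * vz (E s) <> 0.
Proof.
intros hs; unfold admissible, unit_normal.
rewrite ruled_cross_partials by trivial.
set (v := comb _ _ _ _ _ _).
assert (hv : vz v = N_D s * vz (D s) - N_E s t * vz (E s))
  by (unfold v; rewrite vz_comb; ring).
assert (e : forall c, vz (vscal c v) = c * vz v) by reflexivity.
rewrite <- hv, e; clearbody v; clear e hv; split.
- intros [_ h] h0; apply h; rewrite h0; ring.
- intros h0.
  assert (h : v <> (0, 0, 0)) by (intros e; apply h0; now rewrite e).
  split; trivial.
  apply Rmult_integral_contrapositive_currified; trivial.
  apply Rinv_neq_0_compat.
  apply Rgt_not_eq, sqrt_lt_R0.
  pose proof (Rsqr_pos_lt _ h0) as hp; unfold Rsqr in hp; unfold dot.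
  pose proof (Rle_0_sqr (vx v)); pose proof (Rle_0_sqr (vy v)); unfold Rsqr in *; lra.
Qed.

(** This is [aniso_mean_curvature_eq] in frame coordinates, with [X_st = beta'] and [X_tt = 0]. As
    [hdot] is [dot] minus the product of the heights, only [f], [g], [n] remain of the frame. *)
Lemma ruled_mean_curvature (Lam s t : R) :
  in_itv lo hi s -> is_aniso_mean_curvature X s t Lam ->
  let f := vz (B s) in let g := vz (D s) in let n := vz (E s) in
  let p := N_D s in let w := N_E s t in
  let k' := Derive k s in
  let p' := Derive (Derive b) s + k' * a s + k s * Derive a s in
  let w' := Derive (Derive a) s - k' * b s - k s * Derive b s in
  Lam / 2 * (p * g - w * n) ^ 3 =
    (1 - f ^ 2) * (- k s * w ^ 2 - p' * w + p * (w' - a s - k s * p))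
    + 2 * p * (a s * (1 - f ^ 2) + f * g * w + f * n * p).
Proof.
intros hs hL f g n p w k' p' w'.
assert (fs := frame s hs).
assert (cst : forall c r, is_derive (fun _ : R => c) r 0)
  by (intros; apply (is_derive_const (V := R_NormedModule))).
assert (dk' := Derive_correct k s (dk s hs)).
assert (da := smooth_on_derive lo hi a s ha hs).
assert (db := smooth_on_derive lo hi b s hb hs).
assert (da' := smooth_on_derive lo hi _ s (smooth_on_Derive _ _ _ ha) hs).
assert (db' := smooth_on_derive lo hi _ s (smooth_on_Derive _ _ _ hb) hs).
assert (near : locally_2d (fun v w => in_itv lo hi v) s t).
{ destruct (in_itv_locally lo hi s hs) as [d hd]; exists d; intros v r hv _; now apply hd. }
(* The components of [X] are affine in [t], with coefficients differentiable in [s]; this yields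
   joint continuity. *)
assert (cont : forall F : R -> R -> R, (exists A C, ex_derive A s /\ ex_derive C s /\
  forall v w, F v w = A v + w * C v) -> continuity_2d_pt F s t).
{ intros F (A & C & dA & dC & e).
  apply (continuity_2d_pt_ext (fun v w => A v + w * C v)); [now intros|].
  assert (c1 : forall h : R -> R, ex_derive h s -> continuity_2d_pt (fun v _ => h v) s t).
  { intros h dh; apply (continuity_1d_2d_pt_comp h (fun v _ => v)).
    - destruct dh as [l dl]; apply derivable_continuous_pt; exists l; now apply is_derive_Reals.
    - apply continuity_2d_pt_id1. }
  apply continuity_2d_pt_plus; [now apply c1|].
  apply continuity_2d_pt_mult; [apply continuity_2d_pt_id2|now apply c1]. }
(* At [t = 0] the surface reduces to its directrix, so this provides the differentiability of the
   directrix. *)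
assert (dal := is_vderive_ruled_s s 0 hs).
(* The coordinates of [X_ss] come from [is_vderive_comb] applied to those of [X_s], namely [- a],
   [N_E] and [N_D]. *)
assert (h := aniso_mean_curvature_eq X ruled_ds (fun v _ => B v)
  (comb (B s) (D s) (E s) (- Derive a s - w) (- a s + w' - k s * p) (p' + k s * w))
  (comb (B s) (D s) (E s) 0 1 0) (comb (B s) (D s) (E s) 0 0 0) s t Lam).
cbv beta zeta in h.
assert (eN : cross (ruled_ds s t) (B s) = comb (B s) (D s) (E s) 0 p (- w)).
{ destruct fs; now apply cross_comb. }
assert (eB : B s = comb (B s) (D s) (E s) 1 0 0).
{ apply vec3_ext; unfold comb, vadd, vscal, vx, vy, vz; simpl; ring. }
rewrite eN in h.
assert (h1 : Lam / 2 * (p * g - w * n) ^ 3 =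
  dot (comb (B s) (D s) (E s) (- Derive a s - w) (- a s + w' - k s * p) (p' + k s * w))
    (comb (B s) (D s) (E s) 0 p (- w)) * hdot (B s) (B s)
  - 2 * dot (comb (B s) (D s) (E s) 0 1 0) (comb (B s) (D s) (E s) 0 p (- w))
     * hdot (ruled_ds s t) (B s)
  + dot (comb (B s) (D s) (E s) 0 0 0) (comb (B s) (D s) (E s) 0 p (- w))
     * hdot (ruled_ds s t) (ruled_ds s t)).
{ rewrite <- h; clear h.
  - rewrite vz_comb; unfold f, g, n; ring.
  - revert near; apply locally_2d_impl, locally_2d_forall; intros; now apply is_vderive_ruled_s.
  - apply locally_2d_forall; intros; apply is_vderive_ruled_t.
  - apply cont.
    exists (fun v => vx (directrix B a b v)), (fun v => vx (B v)); repeat split.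
    + destruct dal as (l & _); exists (vx (ruled_ds s 0)).
      eapply is_derive_ext; [|exact l]; intros r; simpl.
      unfold X, ruled, vadd, vscal, vx; simpl; ring.
    + exists (vx (D s)); apply fs.
  - apply cont.
    exists (fun v => vy (directrix B a b v)), (fun v => vy (B v)); repeat split.
    + destruct dal as (_ & l & _); exists (vy (ruled_ds s 0)).
      eapply is_derive_ext; [|exact l]; intros r; simpl.
      unfold X, ruled, vadd, vscal, vy; simpl; ring.
    + exists (vy (D s)); apply fs.
  - apply is_vderive_comb with (u := fun r => - a r) (v := fun r => N_E r t) (w := N_D)
      (u' := - Derive a s) (v' := w') (w' := p'); trivial.
    + now apply (is_derive_opp (V := R_NormedModule)).
    + evar_last.
      * apply (is_derive_minus (V := R_NormedModule)); [|apply is_derive_Rmult; eassumption].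
        apply (is_derive_plus (V := R_NormedModule)); [apply cst|eassumption].
      * unfold w', k', minus, plus, opp; simpl; ring.
    + evar_last.
      * apply (is_derive_plus (V := R_NormedModule)); [eassumption|].
        apply is_derive_Rmult; eassumption.
      * unfold p', k', plus; simpl; ring.
  - replace (comb (B s) (D s) (E s) 0 1 0) with (D s); [apply fs|].
    apply vec3_ext; unfold comb, vadd, vscal, vx, vy, vz; simpl; ring.
  - replace (comb (B s) (D s) (E s) 0 0 0) with ((0, 0, 0) : vec3);
      [split; [|split]; exact (cst _ _)|].
    apply vec3_ext; unfold comb, vadd, vscal, vx, vy, vz; simpl; ring.
  - exact hL. }
rewrite h1, !hdot_dot; unfold ruled_ds; clear h h1 eN.
fold p w.
pose proof (frame_BB _ _ _ _ _ fs) as hBB; pose proof (frame_DD _ _ _ _ _ fs) as hDD;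
  pose proof (frame_BD _ _ _ _ _ fs) as hBD.
replace (dot (comb (B s) (D s) (E s) (- a s) w p) (B s)) with (- a s).
2: { transitivity (dot (comb (B s) (D s) (E s) (- a s) w p) (comb (B s) (D s) (E s) 1 0 0));
     [unfold E; rewrite dot_comb by trivial; ring|now rewrite <- eB]. }
unfold E; rewrite !dot_comb, !vz_comb by trivial.
fold (E s) f g n; rewrite hBB; ring.
Qed.

Let f s := vz (B s).
Let g s := vz (D s).
Let n s := vz (E s).

(** The three heights are the coordinates of the unit vector [e_3] in the orthonormal frame. *)
Lemma frame_row (s : R) : in_itv lo hi s -> f s ^ 2 + g s ^ 2 + n s ^ 2 = 1.
Proof.
intros hs; destruct (frame s hs) as [hB hD hBD _ _ _ _].
unfold f, g, n, E.
assert (e : vz (cross (B s) (D s)) ^ 2 =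
  (dot (B s) (B s) - vz (B s) ^ 2) * (dot (D s) (D s) - vz (D s) ^ 2)
  - (dot (B s) (D s) - vz (B s) * vz (D s)) ^ 2)
  by (unfold dot, cross, vx, vy, vz; simpl; ring).
rewrite e, hB, hD, hBD; ring.
Qed.

Lemma is_derive_f (s : R) : in_itv lo hi s -> is_derive f s (g s).
Proof. intros hs; apply (frame s hs). Qed.

Lemma is_derive_g (s : R) : in_itv lo hi s -> is_derive g s (- f s + k s * n s).
Proof.
intros hs; destruct (frame_dD _ _ _ _ _ (frame s hs)) as (_ & _ & h).
evar_last; [exact h|]; unfold f, n, vadd, vscal, vz; simpl; ring.
Qed.

Lemma is_derive_n (s : R) : in_itv lo hi s -> is_derive n s (- k s * g s).
Proof. intros hs; apply (frame s hs). Qed.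

(** One admissible point on the ruling makes [p g - w n] a nonzero polynomial of degree at most one
    in [w]. Hence all [w] but at most one are allowed, and the cubic identity can be read
    coefficient by coefficient. *)
Lemma ruled_coefficients (Lam s t : R) :
  (forall s t, in_itv lo hi s -> admissible X s t -> is_aniso_mean_curvature X s t Lam) ->
  in_itv lo hi s -> admissible X s t ->
  let p := N_D s in
  let p' := Derive (Derive b) s + Derive k s * a s + k s * Derive a s in
  let w' := Derive (Derive a) s - Derive k s * b s - k s * Derive b s in
  Lam * n s ^ 3 = 0 /\
  3 / 2 * Lam * p * g s * n s ^ 2 + (1 - f s ^ 2) * k s = 0 /\
  - (3 / 2) * Lam * p ^ 2 * g s ^ 2 * n s + (1 - f s ^ 2) * p' - 2 * p * f s * g s = 0 /\
  Lam / 2 * p ^ 3 * g s ^ 3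
    - p * ((1 - f s ^ 2) * (w' + a s - k s * p) + 2 * f s * n s * p) = 0.
Proof.
intros hL hs hst p p' w'.
assert (hw0 : exists w0, forall w, w <> w0 -> p * g s - w * n s <> 0).
{ apply ruled_admissible in hst; trivial; fold (g s) (n s) in hst.
  destruct (Req_dec (n s) 0) as [h|h].
  - exists 0; intros w _; rewrite h in *; intros e; apply hst; unfold p in e; lra.
  - exists (p * g s / n s); intros w hw e; apply hw.
    field_simplify_eq; trivial; lra. }
destruct hw0 as [w0 hw0].
destruct (cubic_vanish (- (Lam / 2) * n s ^ 3)
  (3 / 2 * Lam * p * g s * n s ^ 2 + (1 - f s ^ 2) * k s)
  (- (3 / 2) * Lam * p ^ 2 * g s ^ 2 * n s + (1 - f s ^ 2) * p' - 2 * p * f s * g s)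
  (Lam / 2 * p ^ 3 * g s ^ 3
    - p * ((1 - f s ^ 2) * (w' + a s - k s * p) + 2 * f s * n s * p)) w0)
  as (h3 & h2 & h1 & h0).
- intros w hw.
  (* The point of the ruling at which [N_E] takes the value [w]. *)
  set (t0 := w - Derive a s + k s * b s).
  assert (et : N_E s t0 = w) by (unfold N_E, t0; ring).
  assert (h : admissible X s t0) by (apply ruled_admissible; [|rewrite et; apply hw0]; trivial).
  pose proof (ruled_mean_curvature Lam s t0 hs (hL s t0 hs h)) as e.
  cbv zeta in e; rewrite et in e; fold (f s) (g s) (n s) p p' w' in e.
  apply Rminus_diag_eq in e; rewrite <- e; field.
- repeat split; trivial; lra.
Qed.

(* Where [F] does not vanish, [f ^ 2 = 1], hence [g = n = 0]; but then [g' = - f] is not zero. *)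
Lemma zero_of_horizontal_mul_zero (F : R -> R) :
  (forall s, in_itv lo hi s -> ex_derive F s) ->
  (forall s, in_itv lo hi s -> (1 - f s ^ 2) * F s = 0) ->
  forall s, in_itv lo hi s -> F s = 0.
Proof.
intros dF hF s hs; destruct (Req_dec (F s) 0) as [e|e]; trivial; exfalso.
assert (near : locally s (fun r => f r ^ 2 = 1 /\ g r = 0 /\ n r = 0)).
{ generalize (filter_and _ _ (in_itv_locally lo hi s hs) (locally_neq_0 F s (dF s hs) e)).
  apply filter_imp; intros r [hr er].
  assert (ef : f r ^ 2 = 1).
  { destruct (Rmult_integral _ _ (hF r hr)); [lra|easy]. }
  pose proof (frame_row r hr) as hrow.
  repeat split; trivial; nra. }
assert (dg := is_derive_g s hs).
assert (dg0 : is_derive g s 0).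
{ apply (is_derive_ext_loc (fun _ => 0)); [|apply (is_derive_const (V := R_NormedModule))].
  revert near; apply filter_imp; now intros r (_ & h & _). }
apply is_derive_unique in dg; apply is_derive_unique in dg0.
destruct (locally_singleton _ _ near) as (h1 & _ & h3).
rewrite h3 in dg; rewrite dg in dg0; nra.
Qed.

(** Each coefficient identity is extended by density. The order matters: [Lam n = 0] clears the
    [Lam] term from the identity giving [k = 0], and [k = 0] with [k' = 0] then simplifies the last
    two. *)
Lemma ruled_odes (Lam : R) :
  densely_admissible lo hi X ->
  (forall s t, in_itv lo hi s -> admissible X s t -> is_aniso_mean_curvature X s t Lam) ->
  forall s, in_itv lo hi s ->
  k s = 0 /\ Lam * n s = 0 /\
  (1 - f s ^ 2) * Derive (Derive b) s = 2 * Derive b s * f s * g s /\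
  Lam / 2 * Derive b s ^ 3 * g s ^ 3 =
    Derive b s * ((1 - f s ^ 2) * (Derive (Derive a) s + a s) + 2 * f s * n s * Derive b s).
Proof.
intros hd hL.
assert (dense : forall F : R -> R, (forall s, in_itv lo hi s -> ex_derive F s) ->
  (forall s t, in_itv lo hi s -> admissible X s t -> F s = 0) ->
  forall s, in_itv lo hi s -> F s = 0).
{ intros F dF hF s hs; apply zero_of_dense_zeros; auto; intros eps he.
  destruct (hd s 0 eps hs he) as (r & t & hr & hrs & _ & hrt).
  exists r; split; eauto. }
assert (df : forall s, in_itv lo hi s -> ex_derive f s)
  by (intros s hs; eexists; now apply is_derive_f).
assert (dg : forall s, in_itv lo hi s -> ex_derive g s)
  by (intros s hs; eexists; now apply is_derive_g).
assert (dn : forall s, in_itv lo hi s -> ex_derive n s)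
  by (intros s hs; eexists; now apply is_derive_n).
assert (sa' := smooth_on_Derive _ _ _ ha); assert (sb' := smooth_on_Derive _ _ _ hb).
assert (sa'' := smooth_on_Derive _ _ _ sa'); assert (sb'' := smooth_on_Derive _ _ _ sb').
assert (dsm : forall h : R -> R, smooth_on lo hi h -> forall s, in_itv lo hi s -> ex_derive h s)
  by (intros h sh s hs; eexists; now apply (smooth_on_derive lo hi)).
assert (hn : forall s, in_itv lo hi s -> Lam * n s = 0).
{ apply dense.
  - intros s hs; auto_derive; auto.
  - intros s t hs hst; destruct (ruled_coefficients Lam s t hL hs hst) as (h & _).
    destruct (Rmult_integral _ _ h) as [e|e]; [rewrite e; ring|].
    destruct (Req_dec (n s) 0) as [e0|e0]; [rewrite e0; ring|].
    now destruct (pow_nonzero _ 3 e0). }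
assert (hk : forall s, in_itv lo hi s -> k s = 0).
{ apply zero_of_horizontal_mul_zero; trivial.
  apply dense.
  - intros s hs; auto_derive; auto.
  - intros s t hs hst; destruct (ruled_coefficients Lam s t hL hs hst) as (_ & h & _).
    rewrite <- h; transitivity (3 / 2 * (Lam * n s) * N_D s * g s * n s + (1 - f s ^ 2) * k s);
      [rewrite hn by trivial|]; ring. }
assert (hk' : forall s, in_itv lo hi s -> Derive k s = 0).
{ intros s hs; rewrite (Derive_ext_loc k (fun _ => 0)); [apply Derive_const|].
  generalize (in_itv_locally lo hi s hs); now apply filter_imp. }
intros s hs; split; [|split; [|split]]; auto.
- apply Rminus_diag_uniq; revert s hs; apply dense.
  + intros s hs; auto_derive; repeat split; auto.
  + intros s t hs hst; destruct (ruled_coefficients Lam s t hL hs hst) as (_ & _ & h & _).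
    unfold N_D in h; rewrite hk, hk' in h by trivial.
    rewrite <- h.
    transitivity (- (3 / 2) * (Lam * n s) * Derive b s ^ 2 * g s ^ 2
      + (1 - f s ^ 2) * Derive (Derive b) s - 2 * Derive b s * f s * g s);
      [rewrite hn by trivial|]; ring.
- apply Rminus_diag_uniq; revert s hs; apply dense.
  + intros s hs; auto_derive; repeat split; auto.
  + intros s t hs hst; destruct (ruled_coefficients Lam s t hL hs hst) as (_ & _ & _ & h).
    unfold N_D in h; rewrite hk, hk' in h by trivial.
    rewrite <- h; ring.
Qed.

End RuledSurface.

(** * Rotations about the z-axis and the normal form of great circles *)

Lemma itv_inhabited (lo hi : Rbar) : Rbar_lt lo hi -> exists s, in_itv lo hi s.
Proof.
destruct lo as [lo| |], hi as [hi| |]; simpl; try easy; intros h.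
- exists ((lo + hi) / 2); split; simpl; lra.
- exists (lo + 1); split; simpl; trivial; lra.
- exists (hi - 1); split; simpl; trivial; lra.
- now exists 0.
Qed.

Lemma unit_angle (x y : R) : x ^ 2 + y ^ 2 = 1 -> exists theta, cos theta = x /\ sin theta = y.
Proof.
intros h; assert (hx : -1 <= x <= 1) by nra.
assert (es : 1 - Rsqr x = Rsqr y) by (unfold Rsqr; lra).
destruct (Rle_dec 0 y) as [hy|hy].
- exists (acos x); rewrite cos_acos, sin_acos, es by trivial; split; trivial.
  now apply sqrt_Rsqr.
- exists (- acos x); rewrite cos_neg, sin_neg, cos_acos, sin_acos, es by trivial; split; trivial.
  rewrite sqrt_Rsqr_abs, Rabs_left; lra.
Qed.

(** The rotation brings the horizontal part of [v] onto the y-axis. The sign [e] makes [q]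
    nonnegative; it later becomes the direction of the reparametrization [s |-> e s + c]. *)
Lemma rotate_unit_vector (v : vec3) :
  dot v v = 1 ->
  exists theta e q m, (e = 1 \/ e = -1) /\ 0 <= q /\ 0 <= m /\ q ^ 2 + m ^ 2 = 1 /\
    rotz theta v = (0, - (e * m), e * q).
Proof.
destruct v as [[x y] z]; unfold dot, rotz, vx, vy, vz; simpl; intros h.
assert (he : exists e q, (e = 1 \/ e = -1) /\ 0 <= q /\ z = e * q).
{ destruct (Rle_dec 0 z).
  - exists 1, z; repeat split; auto; ring.
  - exists (-1), (- z); repeat split; auto; lra. }
destruct he as (e & q & he & hq & ->).
pose (m := sqrt (x ^ 2 + y ^ 2)).
assert (hm0 : 0 <= x ^ 2 + y ^ 2) by nra.
assert (hm : m * m = x ^ 2 + y ^ 2) by now apply sqrt_sqrt.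
assert (hm1 : 0 <= m) by apply sqrt_pos.
clearbody m.
assert (he2 : e * e = 1) by (destruct he as [-> | ->]; ring).
assert (hqm : q ^ 2 + m ^ 2 = 1) by nra.
destruct (Req_dec m 0) as [h0|h0].
- exists 0, e, q, m; rewrite cos_0, sin_0; repeat split; trivial.
  assert (x = 0) by nra; assert (y = 0) by nra; subst; f_equal; f_equal; ring.
(* The angle is solved from [x cos theta - y sin theta = 0] and
   [x sin theta + y cos theta = - e m]. *)
- destruct (unit_angle (- (e * y) / m) (- (e * x) / m)) as (theta & hc & hs).
  { transitivity (e * e * (x ^ 2 + y ^ 2) / (m * m)); [now field|].
    rewrite <- hm, he2; now field. }
  exists theta, e, q, m; rewrite hc, hs; repeat split; trivial.
  f_equal; f_equal; [now field|].
  transitivity (- e * (x ^ 2 + y ^ 2) / m); [now field|rewrite <- hm; now field].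
Qed.

(** For [q ^ 2 + m ^ 2 = 1] this is the great circle with unit normal [(0, - m, q)]. With
    [q, m >= 0] it covers all three models: horizontal for [m = 0], vertical for [q = 0], tilted
    otherwise. *)
Definition circle (q m s : R) : vec3 := (cos s, q * sin s, m * sin s).
Definition circle_tangent (q m s : R) : vec3 := (- sin s, q * cos s, m * cos s).

Lemma rotz_dot (theta : R) (p q : vec3) : dot (rotz theta p) (rotz theta q) = dot p q.
Proof.
pose proof (sin2_cos2 theta) as h; unfold Rsqr in h.
transitivity ((sin theta * sin theta + cos theta * cos theta) * (vx p * vx q + vy p * vy q)
  + vz p * vz q); [|rewrite h]; unfold dot, rotz, vx, vy, vz; simpl; ring.
Qed.

Lemma rotz_cross (theta : R) (p q : vec3) :
  cross (rotz theta p) (rotz theta q) = rotz theta (cross p q).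
Proof.
pose proof (sin2_cos2 theta) as h; unfold Rsqr in h.
apply vec3_ext; [| |transitivity
  ((sin theta * sin theta + cos theta * cos theta) * vz (cross p q)); [|rewrite h]];
  unfold cross, rotz, vx, vy, vz; simpl; ring.
Qed.

Lemma is_vderive_rotz (theta : R) (F : R -> vec3) (s : R) (v : vec3) :
  is_vderive F s v -> is_vderive (fun r => rotz theta (F r)) s (rotz theta v).
Proof.
intros (h1 & h2 & h3); split; [|split]; simpl.
- apply (is_derive_minus (V := R_NormedModule)); now apply is_derive_scal.
- apply (is_derive_plus (V := R_NormedModule)); now apply is_derive_scal.
- exact h3.
Qed.

(** * From the differential equations to the models *)

Section Models.

Context (lo hi : Rbar) (B : R -> vec3) (a b : R -> R) (theta e c q m : R).

(** Reversing the parameter reverses both [beta'] and [beta x beta'], whence the factor [e] in the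
    last two equations. *)
Definition on_circle : Prop :=
  forall s, in_itv lo hi s ->
    rotz theta (B s) = circle q m (e * s + c) /\
    rotz theta (vderive B s) = vscal e (circle_tangent q m (e * s + c)) /\
    rotz theta (cross (B s) (vderive B s)) = (0, - (e * m), e * q).

Context (he : e = 1 \/ e = -1).

Let he2 : e * e = 1.
Proof. destruct he as [-> | ->]; ring. Qed.

Lemma is_derive_comp_affine (F : R -> R) (s l : R) :
  is_derive F (e * s + c) l -> is_derive (fun r => F (e * r + c)) s (e * l).
Proof.
intros h; apply (is_derive_comp F (fun r => e * r + c)); trivial.
auto_derive; trivial; ring.
Qed.

Lemma harmonic_on (lo' hi' : Rbar) (h h' : R -> R) :
  Rbar_lt lo' hi' ->
  (forall s, in_itv lo' hi' s -> is_derive h s (h' s)) ->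
  (forall s, in_itv lo' hi' s -> is_derive h' s (- h s)) ->
  exists k1 k2, forall s, in_itv lo' hi' s ->
    h s = k1 * cos (e * s + c) + k2 * sin (e * s + c).
Proof.
intros hI dh dh'; destruct (itv_inhabited _ _ hI) as [r hr].
(* The expected formula for [h] and its derivative, solved for the two coefficients; [h'' = - h]
   makes both constant. *)
pose (K1 := fun s => h s * cos (e * s + c) - e * (h' s * sin (e * s + c))).
pose (K2 := fun s => h s * sin (e * s + c) + e * (h' s * cos (e * s + c))).
assert (dc : forall s, is_derive (fun r => cos (e * r + c)) s (- e * sin (e * s + c)))
  by (intros; auto_derive; trivial; ring).
assert (ds : forall s, is_derive (fun r => sin (e * r + c)) s (e * cos (e * s + c)))
  by (intros; auto_derive; trivial; ring).
assert (e1 : forall s, in_itv lo' hi' s -> K1 s = K1 r).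
{ intros s hs; apply (derive_zero_const lo' hi'); trivial; clear s hs; intros s hs.
  evar_last.
  - apply (is_derive_minus (V := R_NormedModule)).
    + apply is_derive_Rmult; [now apply dh|apply dc].
    + apply is_derive_scal; apply is_derive_Rmult; [now apply dh'|apply ds].
  - unfold minus, plus, opp, scal; simpl; unfold mult; simpl.
    transitivity ((e * e - 1) * - (h' s * cos (e * s + c))); [ring|rewrite he2; ring]. }
assert (e2 : forall s, in_itv lo' hi' s -> K2 s = K2 r).
{ intros s hs; apply (derive_zero_const lo' hi'); trivial; clear s hs; intros s hs.
  evar_last.
  - apply (is_derive_plus (V := R_NormedModule)).
    + apply is_derive_Rmult; [now apply dh|apply ds].
    + apply is_derive_scal; apply is_derive_Rmult; [now apply dh'|apply dc].
  - unfold minus, plus, opp, scal; simpl; unfold mult; simpl.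
    transitivity ((1 - e * e) * (h' s * sin (e * s + c))); [ring|rewrite he2; ring]. }
exists (K1 r), (K2 r); intros s hs; rewrite <- (e1 s hs), <- (e2 s hs); unfold K1, K2.
transitivity (h s * (Rsqr (sin (e * s + c)) + Rsqr (cos (e * s + c))));
  [rewrite sin2_cos2|unfold Rsqr]; ring.
Qed.

(** The numbers [v1], [v2], [v3] are the coordinates of the translation along [(1, 0, 0)],
    [(0, q, m)] and [(0, - m, q)]. In the frame of the circle its tangential part is
    [- v1 sin + v2 cos], added to [e a], and its normal part is [v3], added to [e b]. *)
Lemma congruent_on_circle (beta0 : R -> vec3) (a0 b0 : R -> R) (lo' hi' : Rbar) (v1 v2 v3 : R) :
  on_circle -> (forall s, beta0 s = circle q m s) ->
  Rbar_le lo lo' -> Rbar_le hi' hi ->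
  (forall s, in_itv lo' hi' s ->
    a0 (e * s + c) = e * a s - v1 * sin (e * s + c) + v2 * cos (e * s + c) /\
    b0 (e * s + c) = e * b s + v3) ->
  congruent_on lo' hi' theta (v1, q * v2 - m * v3, m * v2 + q * v3) e c B a b beta0 a0 b0.
Proof.
intros hc h0 hlo hhi hab s hs.
assert (hs' : in_itv lo hi s).
{ destruct hs as [l1 l2]; split.
  - now apply Rbar_le_lt_trans with lo'.
  - now apply Rbar_lt_le_trans with hi'. }
destruct (hc s hs') as (eB & eD & eE), (hab s hs) as (ea & eb).
set (r := e * s + c) in *.
assert (d0 : vderive beta0 r = circle_tangent q m r).
{ apply is_vderive_unique; apply (is_vderive_ext (circle q m)); [easy|].
  split; [|split]; unfold circle, circle_tangent, vx, vy, vz; simpl;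
    auto_derive; trivial; ring. }
(* The component of the translation along the ruling. *)
exists (v1 * cos r + v2 * sin r); intros t.
assert (el : rotz theta (ruled B a b s t) = vadd (vscal t (rotz theta (B s)))
  (vadd (vscal (a s) (rotz theta (vderive B s)))
    (vscal (b s) (rotz theta (cross (B s) (vderive B s)))))).
{ apply vec3_ext; unfold ruled, directrix, vadd, vscal, rotz, vx, vy, vz; simpl; ring. }
pose proof (sin2_cos2 r) as h1; unfold Rsqr in h1.
assert (e0 : cross (circle q m r) (circle_tangent q m r) = (0, - m, q)).
{ apply vec3_ext.
  - unfold cross, circle, circle_tangent, vx, vy, vz; simpl; ring.
  - transitivity (- m * (sin r * sin r + cos r * cos r)); [|rewrite h1];
      unfold cross, circle, circle_tangent, vx, vy, vz; simpl; ring.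
  - transitivity (q * (sin r * sin r + cos r * cos r)); [|rewrite h1];
      unfold cross, circle, circle_tangent, vx, vy, vz; simpl; ring. }
rewrite el, eB, eD, eE; unfold ruled, directrix; rewrite d0, h0, e0, ea, eb.
apply vec3_ext; apply Rminus_diag_uniq.
- transitivity (v1 * (1 - (sin r * sin r + cos r * cos r))); [|rewrite h1];
    unfold circle, circle_tangent, vadd, vscal, vx, vy, vz; simpl; ring.
- transitivity (q * v2 * (1 - (sin r * sin r + cos r * cos r))); [|rewrite h1];
    unfold circle, circle_tangent, vadd, vscal, vx, vy, vz; simpl; ring.
- transitivity (m * v2 * (1 - (sin r * sin r + cos r * cos r))); [|rewrite h1];
    unfold circle, circle_tangent, vadd, vscal, vx, vy, vz; simpl; ring.
Qed.

(* The solutions of [h'' + h = 0] are the components of constant vectors along the tangent of the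
   circle, so a translation turns any solution [a0] into the given particular one [A0]. *)
Lemma is_model_of_odes (beta0 : R -> vec3) (dom : R -> Prop)
    (family : (R -> R) -> (R -> R) -> Prop) (A0 A1 F B0 G : R -> R) :
  on_circle -> (forall s, beta0 s = circle q m s) ->
  smooth_on lo hi a -> smooth_on lo hi b ->
  (forall s, dom s -> is_derive A0 s (A1 s)) ->
  (forall s, dom s -> is_derive A1 s (F s - A0 s)) ->
  (forall s, dom s -> is_derive B0 s (G s)) ->
  (forall s, in_itv lo hi s -> dom (e * s + c) ->
     e * (Derive (Derive a) s + a s) = F (e * s + c) /\ Derive b s = G (e * s + c)) ->
  family A0 B0 ->
  is_model lo hi B a b beta0 dom family.
Proof.
intros hc h0 ha hb dA0 dA1 dB0 hab hfam.
exists theta, e, c; split; [exact he|split].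
{ intros s hs; rewrite h0; now apply hc. }
intros lo' hi' hlo hI hhi hdom.
assert (sub : forall s, in_itv lo' hi' s -> in_itv lo hi s).
{ intros s [l1 l2]; split.
  - now apply Rbar_le_lt_trans with lo'.
  - now apply Rbar_lt_le_trans with hi'. }
(* Both [e a] and the pulled-back [A0] solve the same inhomogeneous equation, so their difference is
   harmonic. *)
destruct (harmonic_on lo' hi' (fun s => e * a s - A0 (e * s + c))
  (fun s => e * Derive a s - e * A1 (e * s + c))) as (k1 & k2 & hk); trivial.
{ intros s hs; apply (is_derive_minus (V := R_NormedModule)).
  - apply is_derive_scal, (smooth_on_derive lo hi); auto.
  - apply is_derive_comp_affine; auto. }
{ intros s hs; evar_last.
  - apply (is_derive_minus (V := R_NormedModule)).
    + apply is_derive_scal, (smooth_on_derive lo hi); auto; now apply smooth_on_Derive.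
    + apply is_derive_scal, is_derive_comp_affine; auto.
  - destruct (hab s (sub s hs) (hdom s hs)) as [h _].
    unfold minus, plus, opp, scal; simpl; unfold mult; simpl.
    rewrite <- h; transitivity (e * Derive (Derive a) s
      - e * e * (e * (Derive (Derive a) s + a s) - A0 (e * s + c))); [ring|rewrite he2; ring]. }
destruct (itv_inhabited _ _ hI) as [r hr].
assert (hB : forall s, in_itv lo' hi' s ->
  e * b s - B0 (e * s + c) = e * b r - B0 (e * r + c)).
{ intros s hs; apply (derive_zero_const lo' hi' (fun s => e * b s - B0 (e * s + c))); trivial.
  clear s hs; intros s hs; evar_last.
  - apply (is_derive_minus (V := R_NormedModule)).
    + apply is_derive_scal, (smooth_on_derive lo hi); auto.
    + apply is_derive_comp_affine; auto.
  - destruct (hab s (sub s hs) (hdom s hs)) as [_ h].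
    unfold minus, plus, opp, scal; simpl; unfold mult; simpl; rewrite h; ring. }
exists A0, B0; eexists; split; [exact hfam|].
(* Comparing [e a - A0 = k1 cos + k2 sin] with the tangential part of a translation gives [v1 = k2]
   and [v2 = - k1]; [v3] is the constant difference of [B0] and [e b]. *)
apply (congruent_on_circle beta0 A0 B0 lo' hi' k2 (- k1) (B0 (e * r + c) - e * b r)); trivial.
intros s hs; split.
- specialize (hk s hs); simpl in hk; lra.
- specialize (hB s hs); lra.
Qed.

End Models.

(** * Parametrization of [beta] by arc length on its great circle *)

(** The rotated [beta] and [beta'] lie in the plane orthogonal to the constant normal, with
    coordinates [(C, S)] and [(C', S')]. Orthonormality and orientation force [C' = - e S] and
    [S' = e C], a uniform rotation. *)
Lemma on_circle_exists (lo hi : Rbar) (B : R -> vec3) (theta e q m : R) :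
  Rbar_lt lo hi -> e = 1 \/ e = -1 -> q ^ 2 + m ^ 2 = 1 ->
  (forall s, in_itv lo hi s ->
    frame_at s B (vderive B) (fun r => cross (B r) (vderive B r)) 0) ->
  (forall s, in_itv lo hi s ->
    rotz theta (cross (B s) (vderive B s)) = (0, - (e * m), e * q)) ->
  exists c, on_circle lo hi B theta e c q m.
Proof.
intros hI he hqm hF hE.
assert (he2 : e * e = 1) by (destruct he as [-> | ->]; ring).
pose (V := fun s => rotz theta (B s)).
pose (W := fun s => rotz theta (vderive B s)).
pose (C := fun s => vx (V s)); pose (S := fun s => q * vy (V s) + m * vz (V s)).
pose (C' := fun s => vx (W s)); pose (S' := fun s => q * vy (W s) + m * vz (W s)).
assert (span : forall v : vec3, - (e * m) * vy v + e * q * vz v = 0 ->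
  v = (vx v, q * (q * vy v + m * vz v), m * (q * vy v + m * vz v))).
{ intros v hv.
  assert (hv' : q * vz v = m * vy v).
  { apply (Rmult_eq_reg_l e); [lra|intros e0; rewrite e0 in he2; lra]. }
  apply vec3_ext; unfold vx, vy, vz in *; simpl.
  - reflexivity.
  - transitivity ((q ^ 2 + m ^ 2) * snd (fst v)); [rewrite hqm; ring|].
    transitivity (q ^ 2 * snd (fst v) + m * (m * snd (fst v))); [ring|rewrite <- hv'; ring].
  - transitivity ((q ^ 2 + m ^ 2) * snd v); [rewrite hqm; ring|].
    transitivity (q * (q * snd v) + m ^ 2 * snd v); [ring|rewrite hv'; ring]. }
assert (eV : forall s, in_itv lo hi s -> V s = (C s, q * S s, m * S s)).
{ intros s hs; apply span.
  transitivity (dot (V s) (0, - (e * m), e * q)); [unfold dot, vx, vy, vz; simpl; ring|].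
  rewrite <- (hE s hs); unfold V; rewrite rotz_dot.
  unfold dot, cross, vx, vy, vz; simpl; ring. }
assert (eW : forall s, in_itv lo hi s -> W s = (C' s, q * S' s, m * S' s)).
{ intros s hs; apply span.
  transitivity (dot (W s) (0, - (e * m), e * q)); [unfold dot, vx, vy, vz; simpl; ring|].
  rewrite <- (hE s hs); unfold W; rewrite rotz_dot.
  unfold dot, cross, vx, vy, vz; simpl; ring. }
assert (unit : forall s, in_itv lo hi s -> C s ^ 2 + S s ^ 2 = 1).
{ intros s hs; transitivity (dot (V s) (V s)).
  - rewrite eV by trivial; unfold dot, vx, vy, vz; simpl.
    transitivity (C s ^ 2 + (q ^ 2 + m ^ 2) * S s ^ 2); [rewrite hqm|]; ring.
  - unfold V; rewrite rotz_dot; now destruct (hF s hs). }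
assert (ort : forall s, in_itv lo hi s -> C s * C' s + S s * S' s = 0).
{ intros s hs; transitivity (dot (V s) (W s)).
  - rewrite eV, eW by trivial; unfold dot, vx, vy, vz; simpl.
    transitivity (C s * C' s + (q ^ 2 + m ^ 2) * (S s * S' s)); [rewrite hqm|]; ring.
  - unfold V, W; rewrite rotz_dot; now destruct (hF s hs). }
assert (orient : forall s, in_itv lo hi s -> C s * S' s - S s * C' s = e).
{ intros s hs; assert (h : cross (V s) (W s) = (0, - (e * m), e * q))
    by (unfold V, W; rewrite rotz_cross; auto).
  rewrite eV, eW in h by trivial; unfold cross, vx, vy, vz in h; simpl in h.
  injection h as _ h1 h2.
  transitivity ((q ^ 2 + m ^ 2) * (C s * S' s - S s * C' s)); [rewrite hqm; ring|].
  transitivity (q * (C s * (q * S' s) - q * S s * C' s)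
    - m * (m * S s * C' s - C s * (m * S' s))); [ring|].
  rewrite h1, h2; transitivity (e * (q ^ 2 + m ^ 2)); [|rewrite hqm]; ring. }
assert (eC' : forall s, in_itv lo hi s -> C' s = - e * S s).
{ intros s hs; transitivity (C' s * (C s ^ 2 + S s ^ 2)); [rewrite unit by trivial; ring|].
  transitivity (C s * (C s * C' s + S s * S' s) - S s * (C s * S' s - S s * C' s)); [ring|].
  rewrite ort, orient by trivial; ring. }
assert (eS' : forall s, in_itv lo hi s -> S' s = e * C s).
{ intros s hs; transitivity (S' s * (C s ^ 2 + S s ^ 2)); [rewrite unit by trivial; ring|].
  transitivity (S s * (C s * C' s + S s * S' s) + C s * (C s * S' s - S s * C' s)); [ring|].
  rewrite ort, orient by trivial; ring. }
assert (dC : forall s, in_itv lo hi s -> is_derive C s (- e * S s)).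
{ intros s hs; rewrite <- eC' by trivial.
  apply (is_vderive_rotz theta B s (vderive B s)); now destruct (hF s hs). }
assert (dS : forall s, in_itv lo hi s -> is_derive S s (e * C s)).
{ intros s hs; rewrite <- eS' by trivial.
  destruct (is_vderive_rotz theta B s (vderive B s)) as (_ & h2 & h3);
    [now destruct (hF s hs)|].
  apply (is_derive_plus (V := R_NormedModule)); now apply is_derive_scal. }
destruct (itv_inhabited _ _ hI) as [s0 hs0].
destruct (unit_angle (C s0) (S s0) (unit s0 hs0)) as (phi & hcos & hsin).
(* The phase for which [e s + c] equals the angle [phi] at [s0]. *)
exists (phi - e * s0).
set (c := phi - e * s0).
(* The inner product of the two unit vectors [(C, S)] and [(cos, sin)] is constant and equals 1 at
   [s0]; unit vectors with inner product 1 coincide. *)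
assert (h : forall s, in_itv lo hi s ->
  C s * cos (e * s + c) + S s * sin (e * s + c) = 1).
{ assert (e0 : e * s0 + c = phi) by (unfold c; ring).
  rewrite <- (unit s0 hs0); intros s hs.
  transitivity (C s0 * cos (e * s0 + c) + S s0 * sin (e * s0 + c));
    [|rewrite e0, hcos, hsin; ring].
  apply (derive_zero_const lo hi (fun s => C s * cos (e * s + c) + S s * sin (e * s + c)));
    trivial; clear s hs; intros s hs; evar_last.
  - apply (is_derive_plus (V := R_NormedModule)); apply is_derive_Rmult; auto.
    + apply (is_derive_comp_affine e c cos s), is_derive_cos.
    + apply (is_derive_comp_affine e c sin s), is_derive_sin.
  - unfold plus; simpl; ring. }
assert (eCS : forall s, in_itv lo hi s -> C s = cos (e * s + c) /\ S s = sin (e * s + c)).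
{ intros s hs; pose proof (h s hs) as h1; pose proof (unit s hs) as h2.
  pose proof (sin2_cos2 (e * s + c)) as h3; unfold Rsqr in h3.
  set (x := cos (e * s + c)) in *; set (y := sin (e * s + c)) in *.
  destruct (Rplus_sqr_eq_0 (C s - x) (S s - y)); [unfold Rsqr; lra|split; lra]. }
intros s hs; destruct (eCS s hs) as [e1 e2].
change (rotz theta (B s)) with (V s); change (rotz theta (vderive B s)) with (W s).
rewrite eV, eW, eC', eS', e1, e2 by trivial; repeat split; auto.
apply vec3_ext; unfold circle_tangent, vscal, vx, vy, vz; simpl; ring.
Qed.

(** * Particular solutions on the tilted and vertical circles *)

Lemma is_derive_tan_cos (s : R) : cos s <> 0 -> is_derive tan s (/ cos s ^ 2).
Proof.
intros h; unfold tan; auto_derive; trivial.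
pose proof (sin2_cos2 s) as h1; unfold Rsqr in h1.
field_simplify_eq; trivial; lra.
Qed.

Lemma is_derive_atan_scaled_tan (q s : R) :
  cos s <> 0 ->
  is_derive (fun r => atan (q * tan r)) s (q / (cos s ^ 2 + q ^ 2 * sin s ^ 2)).
Proof.
intros h; evar_last.
- apply (is_derive_comp atan (fun r => q * tan r)); [apply is_derive_atan|].
  apply is_derive_scal; now apply is_derive_tan_cos.
- assert (0 < cos s ^ 2) by (pose proof (Rsqr_pos_lt _ h); unfold Rsqr in *; nra).
  assert (0 <= (q * sin s) ^ 2) by apply pow2_ge_0.
  unfold scal; simpl; unfold mult; simpl; unfold tan, Rsqr; field.
  repeat split; trivial; nra.
Qed.

Lemma tilted_family_odes (q m C : R) :
  0 < q -> 0 < m -> q ^ 2 + m ^ 2 = 1 ->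
  let D s := 1 - m ^ 2 * sin s ^ 2 in
  exists A0 A1 B0 : R -> R,
    (forall s, tan_dom s -> is_derive A0 s (A1 s)) /\
    (forall s, tan_dom s -> is_derive A1 s (- 2 * C * m * q * sin s / D s ^ 2 - A0 s)) /\
    (forall s, tan_dom s -> is_derive B0 s (C / D s)) /\
    (C <> 0 -> tilted_family m A0 B0).
Proof.
intros hq hm hqm D.
assert (esq : sqrt (1 - m ^ 2) = q).
{ replace (1 - m ^ 2) with (q ^ 2) by lra; apply sqrt_pow2; lra. }
pose (phi := fun s => acot (q * tan s)).
assert (hD : forall s, 0 < D s).
{ intros s; pose proof (sin2_cos2 s) as h; unfold Rsqr in h; unfold D.
  pose proof (pow2_ge_0 (cos s)); pose proof (pow2_ge_0 (sin s)).
  pose proof (pow_lt q 2 hq); nra. }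
assert (eD : forall s, cos s ^ 2 + q ^ 2 * sin s ^ 2 = D s).
{ intros s; pose proof (sin2_cos2 s) as h; unfold Rsqr in h; unfold D.
  replace (q ^ 2) with (1 - m ^ 2) by lra; lra. }
assert (datan : forall s, tan_dom s -> is_derive (fun r => atan (q * tan r)) s (q / D s)).
{ intros s hs; rewrite <- eD; now apply is_derive_atan_scaled_tan. }
assert (dphi : forall s, tan_dom s -> is_derive phi s (- (q / D s))).
{ intros s hs; evar_last.
  - apply (is_derive_minus (V := R_NormedModule));
      [apply (is_derive_const (V := R_NormedModule))|now apply datan].
  - unfold minus, plus, opp, zero; simpl; ring. }
assert (dD : forall s, is_derive D s (- (2 * m ^ 2 * sin s * cos s)))
  by (intros s; unfold D; auto_derive; trivial; ring).
(* The coefficients of the family with [c1 = c2 = 0] and [b1 = C]. The term [L sin] is harmonic and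
   only serves to match the stated form. *)
pose (K := C * m / q ^ 2); pose (L := C / (m * q)).
exists (fun s => - (K * (cos s * phi s)) + L * sin s),
  (fun s => K * (sin s * phi s) + K * q * (cos s / D s) + L * cos s),
  (fun s => C / q * atan (q * tan s)); split; [|split; [|split]].
- intros s hs; evar_last.
  + apply (is_derive_plus (V := R_NormedModule)).
    * apply (is_derive_opp (V := R_NormedModule)), is_derive_scal, is_derive_Rmult;
        [apply is_derive_cos|now apply dphi].
    * apply is_derive_scal, is_derive_sin.
  + unfold plus, opp; simpl; field; apply Rgt_not_eq, hD.
- intros s hs; evar_last.
  + apply (is_derive_plus (V := R_NormedModule)); [apply (is_derive_plus (V := R_NormedModule))|].
    * apply is_derive_scal, is_derive_Rmult; [apply is_derive_sin|now apply dphi].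
    * apply is_derive_scal.
      apply (is_derive_div cos D s); [apply is_derive_cos| |apply Rgt_not_eq, hD].
      exact (dD s).
    * apply is_derive_scal, is_derive_cos.
  (* The terms in [1 / D] and [1 / D ^ 2] combine into a multiple of this difference, which is
     constant. *)
  + assert (e : D s - m ^ 2 * cos s ^ 2 = q ^ 2).
    { pose proof (sin2_cos2 s) as h; unfold Rsqr in h; unfold D.
      replace (q ^ 2) with (1 - m ^ 2 * (sin s * sin s + cos s * cos s)); [ring|rewrite h; lra]. }
    pose proof (Rgt_not_eq _ _ (hD s)) as hDs.
    transitivity (- 2 * K * q * sin s * (D s - m ^ 2 * cos s ^ 2) / D s ^ 2
      + K * (cos s * phi s) - L * sin s).
    * unfold plus, scal; simpl; unfold mult; simpl; now field.
    * rewrite e; unfold K; field; split; (assumption || lra).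
- intros s hs; evar_last; [apply is_derive_scal, datan, hs|].
  unfold scal; simpl; unfold mult; simpl; field; split; apply Rgt_not_eq; [apply hD|exact hq].
- intros hC; exists 0, 0, C; split; trivial; intros s hs; rewrite esq.
  replace (1 - m ^ 2) with (q ^ 2) by lra; split; trivial.
  unfold K, L, phi; field; split; lra.
Qed.

Lemma is_derive_mul_tan (C s : R) : tan_dom s -> is_derive (fun r => C * tan r) s (C / cos s ^ 2).
Proof. intros hs; now apply is_derive_scal, is_derive_tan_cos. Qed.

Lemma vertical_cmc_family_odes (Lam C : R) :
  exists A0 A1 : R -> R,
    (forall s, tan_dom s -> is_derive A0 s (A1 s)) /\
    (forall s, tan_dom s -> is_derive A1 s (Lam * C ^ 2 / (2 * cos s ^ 3) - A0 s)) /\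
    (C <> 0 -> vertical_cmc_family Lam A0 (fun s => C * tan s)).
Proof.
(* By [cos (2 s) = 2 cos s ^ 2 - 1], the last term of the family with [b1 = C] is
   [K (2 cos s - 1 / cos s)]; again [c1 = c2 = 0]. *)
pose (K := - (Lam * C ^ 2) / 4).
exists (fun s => K * (2 * cos s - / cos s)),
  (fun s => K * (- 2 * sin s - sin s / cos s ^ 2)); split; [|split].
- intros s hs; auto_derive; trivial.
  now field.
- intros s hs; auto_derive.
  + rewrite Rmult_1_r; now apply Rmult_integral_contrapositive_currified.
  + assert (e : sin s ^ 2 = 1 - cos s ^ 2)
      by (pose proof (sin2_cos2 s) as h; unfold Rsqr in h; lra).
    transitivity (K * (- 2 * cos s - / cos s - 2 * sin s ^ 2 / cos s ^ 3)); [now field|].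
    rewrite e; unfold K; now field.
- intros hC; exists 0, 0, C; split; trivial; intros s hs; split; trivial.
  rewrite cos_2a_cos; unfold K; now field.
Qed.

(** * The classification *)

Theorem theorem1p1 (lo hi : Rbar) (hI : Rbar_lt lo hi)
    (beta : R -> vec3) (a b : R -> R) (Lam : R)
    (hbeta : vsmooth_on lo hi beta)
    (hsphere : forall s, in_itv lo hi s -> vnorm (beta s) = 1)
    (hspeed : forall s, in_itv lo hi s -> vnorm (vderive beta s) = 1)
    (ha : smooth_on lo hi a) (hb : smooth_on lo hi b)
    (hdense : densely_admissible lo hi (ruled beta a b))
    (hLam : forall s t, in_itv lo hi s -> admissible (ruled beta a b) s t ->
      is_aniso_mean_curvature (ruled beta a b) s t Lam) :
  in_great_circle lo hi beta /\
  ((Lam = 0 /\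
    (in_plane lo hi (ruled beta a b) \/
     is_model lo hi beta a b horizontal_equator (fun _ => True) helicoid_family \/
     is_model lo hi beta a b vertical_equator tan_dom vertical_family \/
     exists m : R, 0 < m < 1 /\
       is_model lo hi beta a b (tilted_circle m) tan_dom (tilted_family m))) \/
   (Lam <> 0 /\
     is_model lo hi beta a b vertical_equator tan_dom (vertical_cmc_family Lam))).
Proof.
destruct (frame_exists lo hi beta hbeta hsphere hspeed) as (k & hk).
assert (frame := fun s hs => proj2 (hk s hs)); assert (dk := fun s hs => proj1 (hk s hs)).
assert (odes := ruled_odes lo hi beta k a b frame dk ha hb Lam hdense hLam); cbv beta in odes.
set (E := fun s => cross (beta s) (vderive beta s)) in *.
assert (frame0 : forall s, in_itv lo hi s -> frame_at s beta (vderive beta) E 0).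
{ intros s hs; destruct (odes s hs) as (e & _); rewrite <- e; auto. }
destruct (itv_inhabited lo hi hI) as [s0 hs0].
assert (hE : forall s, in_itv lo hi s -> E s = E s0).
{ assert (z : forall s, in_itv lo hi s -> is_vderive E s (0, 0, 0)).
  { intros s hs; replace ((0, 0, 0) : vec3) with (vscal (- 0) (vderive beta s));
      [now apply frame0|].
    apply vec3_ext; unfold vscal, vx, vy, vz; simpl; ring. }
  intros s hs; apply vec3_ext.
  - apply (derive_zero_const lo hi (fun s => vx (E s))); trivial; intros; now apply z.
  - apply (derive_zero_const lo hi (fun s => vy (E s))); trivial; intros; now apply z.
  - apply (derive_zero_const lo hi (fun s => vz (E s))); trivial; intros; now apply z. }
assert (unitE : dot (E s0) (E s0) = 1).
{ destruct (frame0 s0 hs0) as [hB hD hBD _ _ _ _].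
  transitivity (dot (beta s0) (beta s0) * dot (vderive beta s0) (vderive beta s0)
    - dot (beta s0) (vderive beta s0) ^ 2); [|rewrite hB, hD, hBD; ring].
  unfold E, dot, cross, vx, vy, vz; simpl; ring. }
assert (normE : vnorm (E s0) = 1) by (unfold vnorm; rewrite unitE; apply sqrt_1).
split.
{ exists (E s0); split; trivial; intros s hs; split; [now apply hsphere|].
  rewrite <- (hE s hs); unfold E, dot, cross, vx, vy, vz; simpl; ring. }
destruct (rotate_unit_vector (E s0) unitE) as (theta & e & q & m & he & hq & hm & hqm & hrot).
assert (hrotE : forall s, in_itv lo hi s -> rotz theta (E s) = (0, - (e * m), e * q))
  by (intros s hs; rewrite hE; trivial).
destruct (on_circle_exists lo hi beta theta e q m hI he hqm frame0 hrotE) as (c & hc).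
assert (he2 : e * e = 1) by (destruct he as [-> | ->]; ring).
assert (fE : forall s, in_itv lo hi s -> vz (beta s) = m * sin (e * s + c)).
{ intros s hs; destruct (hc s hs) as (h & _ & _); exact (f_equal vz h). }
assert (gE : forall s, in_itv lo hi s -> vz (vderive beta s) = e * (m * cos (e * s + c))).
{ intros s hs; destruct (hc s hs) as (_ & h & _); exact (f_equal vz h). }
assert (nE : forall s, in_itv lo hi s -> vz (E s) = e * q).
{ intros s hs; destruct (hc s hs) as (_ & _ & h); exact (f_equal vz h). }
pose (D := fun s => 1 - vz (beta s) ^ 2).
(* The third equation of [ruled_odes] says that [(1 - f ^ 2) b'] has zero derivative. *)
assert (hC : forall s, in_itv lo hi s -> D s * Derive b s = D s0 * Derive b s0).
{ intros s hs; apply (derive_zero_const lo hi (fun s => D s * Derive b s)); trivial.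
  clear s hs; intros s hs; destruct (odes s hs) as (_ & _ & h & _).
  assert (df : is_derive (fun r => vz (beta r)) s (vz (vderive beta s)))
    by apply (frame_dB _ _ _ _ _ (frame0 s hs)).
  evar_last.
  - apply is_derive_Rmult; [|apply (smooth_on_derive lo hi); trivial; now apply smooth_on_Derive].
    apply (is_derive_minus (V := R_NormedModule)); [apply (is_derive_const (V := R_NormedModule))|].
    apply (is_derive_pow (fun r => vz (beta r)) 2 s _ df).
  - transitivity ((1 - vz (beta s) ^ 2) * Derive (Derive b) s
      - 2 * Derive b s * vz (beta s) * vz (vderive beta s)); [|rewrite h; ring].
    unfold minus, plus, opp, zero; simpl; unfold D; ring. }
set (C := D s0 * Derive b s0) in hC; clearbody C.
destruct (Req_dec C 0) as [C0|C0].
{ assert (b0 : forall s, in_itv lo hi s -> Derive b s = 0).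
  { apply (zero_of_horizontal_mul_zero lo hi beta (fun _ => 0) frame0).
    - intros s hs; eexists; apply (smooth_on_derive lo hi); trivial; now apply smooth_on_Derive.
    - intros s hs; rewrite <- C0; apply hC; trivial. }
  left; split.
  (* If [Lam] were nonzero, then [n = 0]; with [b' = 0] and [k = 0] the normal would have zero
     height everywhere, against the existence of an admissible point. *)
  - destruct (Req_dec Lam 0) as [|hL0]; trivial; exfalso.
    destruct (hdense s0 0 1 hs0 Rlt_0_1) as (s & t & hs & _ & _ & hst).
    apply (ruled_admissible lo hi beta k a b frame ha hb s t hs) in hst; apply hst.
    destruct (odes s hs) as (ek & en & _).
    apply Rmult_integral in en; destruct en as [en|en]; [easy|].
    rewrite ek, en, b0 by trivial; ring.
  - left; exists (E s0), (b s0); split; trivial; intros s t hs.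
    transitivity (b s * dot (E s) (E s)).
    + rewrite <- (hE s hs); unfold ruled, directrix; fold (E s).
      unfold E, dot, vadd, vscal, cross, vx, vy, vz; simpl; ring.
    + rewrite (hE s hs), unitE, Rmult_1_r.
      apply (derive_zero_const lo hi b); trivial; intros r hr.
      rewrite <- (b0 r hr); now apply (smooth_on_derive lo hi). }
(* For [C <> 0] the curve avoids the poles and [b'] never vanishes, so the equations can be divided
   by both [D] and [b']. *)
assert (hD : forall s, in_itv lo hi s -> D s <> 0).
{ intros s hs h; apply C0; rewrite <- (hC s hs), h; ring. }
assert (hb' : forall s, in_itv lo hi s -> Derive b s = C / D s).
{ intros s hs; rewrite <- (hC s hs); field; auto. }
assert (D1 : forall s, in_itv lo hi s -> D s = 1 - m ^ 2 * sin (e * s + c) ^ 2).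
{ intros s hs; unfold D; rewrite fE by trivial; ring. }
assert (Dvert : m = 1 -> forall s, in_itv lo hi s -> D s = cos (e * s + c) ^ 2).
{ intros m1 s hs; rewrite D1, m1 by trivial.
  pose proof (sin2_cos2 (e * s + c)) as h; unfold Rsqr in h; lra. }
assert (ha'' : forall s, in_itv lo hi s -> D s * (Derive (Derive a) s + a s) =
  Lam / 2 * Derive b s ^ 2 * (e * (m * cos (e * s + c))) ^ 3
  - 2 * (m * sin (e * s + c)) * (e * q) * Derive b s).
{ intros s hs; destruct (odes s hs) as (_ & _ & _ & h).
  fold (E s) (D s) in h; rewrite fE, gE, nE in h by trivial.
  assert (Derive b s <> 0).
  { intros h0; apply C0; rewrite <- (hC s hs), h0; ring. }
  apply (Rmult_eq_reg_l (Derive b s)); trivial; lra. }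
destruct (Req_dec Lam 0) as [L0|L0].
- left; split; trivial; right.
  destruct (Req_dec m 0) as [m0|m0]; [|destruct (Req_dec q 0) as [q0|q0]; right].
  + left; assert (q1 : q = 1) by nra.
    (* Here [a'' + a = 0], so any harmonic function would do up to translation; [cos] is taken
       because the family asks for [c1 <> 0]. The same choice serves for the vertical equator. *)
    apply (is_model_of_odes lo hi beta a b theta e c q m he) with
      (A0 := cos) (A1 := fun s => - sin s) (F := fun _ => 0) (B0 := fun s => C * s) (G := fun _ => C);
      trivial.
    * intros s; unfold horizontal_equator, circle; rewrite m0, q1; f_equal; [f_equal|]; ring.
    * intros s _; apply is_derive_cos.
    * intros s _; auto_derive; trivial; ring.
    * intros s _; auto_derive; trivial; ring.
    * intros s hs _; rewrite hb' by trivial.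
      assert (d1 : D s = 1) by (rewrite D1, m0 by trivial; ring).
      assert (h := ha'' s hs); rewrite d1, L0, m0 in h; rewrite d1; split; [|field].
      rewrite Rmult_1_l in h; rewrite h; field.
    * exists 1, C; repeat split; auto; ring.
  + left; assert (m1 : m = 1) by nra.
    apply (is_model_of_odes lo hi beta a b theta e c q m he) with
      (A0 := cos) (A1 := fun s => - sin s) (F := fun _ => 0)
      (B0 := fun s => C * tan s) (G := fun s => C / cos s ^ 2); trivial.
    * intros s; unfold vertical_equator, circle; rewrite m1, q0; f_equal; [f_equal|]; ring.
    * intros s _; apply is_derive_cos.
    * intros s _; auto_derive; trivial; ring.
    * intros s hs; now apply is_derive_mul_tan.
    * intros s hs _; rewrite hb', <- Dvert by trivial; split; trivial.
      apply (Rmult_eq_reg_l (D s)); auto.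
      transitivity (e * (D s * (Derive (Derive a) s + a s))); [ring|].
      rewrite ha'', L0, q0 by trivial; field.
    * exists 1, 0, C; repeat split; auto; rewrite Rplus_0_r; ring.
  + right; exists m; split; [nra|].
    destruct (tilted_family_odes q m C) as (A0 & A1 & B0 & h1 & h2 & h3 & h4); try lra.
    (* [F] is the right-hand side of [ha''] divided by [D], with [b' = C / D] and [Lam = 0]. *)
    apply (is_model_of_odes lo hi beta a b theta e c q m he) with
      (A0 := A0) (A1 := A1) (F := fun s => - 2 * C * m * q * sin s / (1 - m ^ 2 * sin s ^ 2) ^ 2)
      (B0 := B0) (G := fun s => C / (1 - m ^ 2 * sin s ^ 2)); auto.
    * intros s; unfold tilted_circle, circle.
      replace (1 - m ^ 2) with (q ^ 2) by lra; now rewrite sqrt_pow2.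
    * intros s hs _; rewrite <- D1 by trivial; split; auto.
      apply (Rmult_eq_reg_l (D s)); auto.
      transitivity (e * (D s * (Derive (Derive a) s + a s))); [ring|].
      rewrite ha'', L0, hb' by trivial.
      transitivity (- 2 * C * m * q * sin (e * s + c) * (e * e) / D s);
        [field|rewrite he2; field]; auto.
- right; split; trivial.
  (* [Lam n = 0] with [n = e q] forces the great circle to be vertical. *)
  assert (q0 : q = 0).
  { destruct (odes s0 hs0) as (_ & h & _); fold (E s0) in h; rewrite nE in h by trivial.
    transitivity (e * (e * q)); [rewrite <- Rmult_assoc, he2; ring|].
    destruct (Rmult_integral _ _ h) as [h'|h']; [easy|rewrite h'; ring]. }
  assert (m1 : m = 1) by nra.
  destruct (vertical_cmc_family_odes Lam C) as (A0 & A1 & h1 & h2 & h3).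
  apply (is_model_of_odes lo hi beta a b theta e c q m he) with
    (A0 := A0) (A1 := A1) (F := fun s => Lam * C ^ 2 / (2 * cos s ^ 3))
    (B0 := fun s => C * tan s) (G := fun s => C / cos s ^ 2); auto.
  + intros s; unfold vertical_equator, circle; rewrite m1, q0; f_equal; [f_equal|]; ring.
  + intros s hs; now apply is_derive_mul_tan.
  + intros s hs hs'; rewrite hb', <- Dvert by trivial; split; trivial.
    apply (Rmult_eq_reg_l (D s)); auto.
    transitivity (e * (D s * (Derive (Derive a) s + a s))); [ring|].
    rewrite ha'', hb', q0, m1, Dvert by trivial.
    transitivity ((e * e) * (e * e) * Lam * C ^ 2 / (2 * cos (e * s + c)));
      [field|rewrite he2; field]; auto.
Qed.
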